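(* Let $(u,\pi)$ be a smooth solution of the 2D stationary Navier-Stokes equations $$-\Delta u+u\cdot\nabla u+\nabla\pi=0,\qquad \operatorname{div}u=0$$ on the entire plane $\mathbb{R}^2$, where $u:\mathbb{R}^2\to\mathbb{R}^2$ and $\pi:\mathbb{R}^2\to\mathbb{R}$. If $\nabla u\in L^q(\mathbb{R}^2)$ for some $1<q<\infty$, then $u$ and $\pi$ are constants. *)

(* Defs.v *)
From HB Require Import structures.
From mathcomp Require Import all_boot all_order all_algebra.
From mathcomp Require Import all_classical all_reals all_analysis.

Set Implicit Arguments.
Unset Strict Implicit.
Unset Printing Implicit Defensive.
Import Order.TTheory GRing.Theory Num.Theory.
Import numFieldNormedType.Exports.
Local Open Scope classical_set_scope.
Local Open Scope ring_scope.

Section Plane.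
Variable R : realType.

Definition e1 : R * R := (1, 0).
Definition e2 : R * R := (0, 1).

(* All iterated partial derivatives of order at most k exist everywhere and are
   continuous. *)
Fixpoint Ck (V : normedModType R) (k : nat) (f : R * R -> V) : Prop :=
  continuous f /\
  (if k is k'.+1 then
     [/\ forall x, derivable f x e1, forall x, derivable f x e2,
         Ck k' ('D_e1 f) & Ck k' ('D_e2 f)]
   else True).

Definition smooth (V : normedModType R) (f : R * R -> V) : Prop :=
  forall k, Ck k f.

Definition gradient (p : R * R -> R) (x : R * R) : R * R :=
  ('D_e1 p x, 'D_e2 p x).

Definition divergence (u : R * R -> R * R) (x : R * R) : R :=
  ('D_e1 u x).1 + ('D_e2 u x).2.

Definition laplacian (V : normedModType R) (f : R * R -> V) (x : R * R) : V :=
  'D_e1 ('D_e1 f) x + 'D_e2 ('D_e2 f) x.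

Definition advection (V : normedModType R) (u : R * R -> R * R)
    (f : R * R -> V) (x : R * R) : V :=
  (u x).1 *: 'D_e1 f x + (u x).2 *: 'D_e2 f x.

Definition stationary_navier_stokes (u : R * R -> R * R) (p : R * R -> R) :=
  forall x, - laplacian u x + advection u u x + gradient p x = 0
            /\ divergence u x = 0.

(* Two-dimensional Lebesgue measure, on the Borel sets of the plane. *)
Definition leb2 : {measure set (measurableTypeR R * measurableTypeR R) -> \bar R} :=
  (@lebesgue_measure R \x @lebesgue_measure R)%E.

(* [Lfun] is only available for real-valued functions; the matrix of first
   partial derivatives is in L^q iff all its entries are. *)
Definition grad_in_Lq (q : R) (u : R * R -> R * R) : Prop :=
  [/\ (fun x => ('D_e1 u x).1) \in Lfun leb2 q%:E,
      (fun x => ('D_e1 u x).2) \in Lfun leb2 q%:E,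
      (fun x => ('D_e2 u x).1) \in Lfun leb2 q%:E &
      (fun x => ('D_e2 u x).2) \in Lfun leb2 q%:E].

End Plane.

(* Main.v *)
Require Import Defs.
From mathcomp Require Import all_boot all_order all_algebra.
From mathcomp Require Import all_classical all_reals all_analysis.
From mathcomp Require Import measurable_realfun ring lra.
Import Order.TTheory GRing.Theory Num.Theory.
Import numFieldNormedType.Exports.
Local Open Scope classical_set_scope.
Local Open Scope ring_scope.

(** The vorticity [w] satisfies [Laplacian w = u . grad w], an equation without
    zero order term, and it lies in [L^q]. Let [h] be a smooth convex function
    dominated by [|s|^q], and comparable to it for large [s] ([exists_profile]), and
    let [eta] be a cut-off of the square of side [2 L]. Testing the equation with [eta h'(w)] gives ([energy_identity])
<<
      int eta h''(w) |grad w|^2 = int h(w) (Laplacian eta + u . grad eta).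
>>
    If the right-hand side tends to [0] with [1 / L], then [h(w)] is constant, and
    integrable, so [w = 0]. The Laplacian of [eta] has size [1 / L^2] and is
    harmless. The difficulty is the drift term: it would be enough that [u] grows
    at most linearly, but [grad u] in [L^q] does not give a pointwise bound when
    [q <= 2].

    What it gives is a bound along lines. Joining [(x, y)] to a fixed segment by a
    horizontal and a vertical line yields, in that square ([profile_growth]),
<<
      |u_1 (x, y)| <= C L + G (y),   G (y) = int_{- L}^{L} h(d_1 u_1 (t, y)) dt,
>>
    where the integral of [G] is bounded independently of [L]. The linear part
    contributes [int h(w) |x| / L], which tends to [0] by integrability
    ([int2_tail]). Against [G], which is merely integrable in [y], the integral of
    [h(w) |d_1 eta|] over a horizontal line must be bounded uniformly in [y]; it is
    at most the integral over the square of the [y]-derivative of the integrand.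
    This has a factor [1 / L] from [d_1 eta], and [|h'(w) d_2 w|] is controlled by
    [h(w) + h''(w) |d_2 w|^2] because [h'^2 <= C h h'']. So the contribution of [G]
    is at most [C (1 + energy) / L], and the energy is absorbed on the left for
    large [L] ([drift_estimate], [energy_estimate], [liouville]). The
    argument is the same for every [q > 1].

    Once [w = 0], the components of [u] are harmonic, so their first derivatives are
    harmonic functions in [L^q] and vanish by the same theorem with zero drift. Then
    [u] is constant, and the momentum equation reduces to [grad p = 0]
    ([liouville_stationary]).

    All integrals but the one in the hypothesis are iterated integrals of continuous
    functions over squares. *)

Set Implicit Arguments.
Unset Strict Implicit.
Unset Printing Implicit Defensive.

(** * Integrals of continuous functions on a segment *)

Section Integral1.
Variable R : realType.
Implicit Types (f g : R -> R) (L : R).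
Local Notation mu := (@lebesgue_measure R).

Fact int1_key : unit. Proof. exact: tt. Qed.

(** Sealed, so that comparing two inequalities between integrals never unfolds
    the construction of the Lebesgue integral. *)
Definition int1 (L : R) (g : R -> R) : R :=
  locked_with int1_key (\int[mu]_(x in `[- L, L]) g x)%R.

Lemma int1E L g : int1 L g = (\int[mu]_(x in `[- L, L]) g x)%R.
Proof. exact: locked_withE. Qed.

Lemma integrable_itv (a b : R) g : continuous g ->
  mu.-integrable `[a, b] (EFin \o g).
Proof.
move=> cg; apply: continuous_compact_integrable; first exact: segment_compact.
exact: continuous_subspaceT.
Qed.

Lemma continuous_normr g : continuous g -> continuous (fun x => `|g x|).
Proof. by move=> cg x; apply: cvg_norm; exact: cg. Qed.

Lemma int1D L f g : continuous f -> continuous g ->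
  int1 L (fun x => f x + g x) = int1 L f + int1 L g.
Proof. by move=> cf cg; rewrite !int1E; apply: RintegralD => //; exact: integrable_itv. Qed.

Lemma int1Z L c g : continuous g -> int1 L (fun x => c * g x) = c * int1 L g.
Proof. by move=> cg; rewrite !int1E; apply: RintegralZl => //; exact: integrable_itv. Qed.

Lemma eq_int1 L f g : (forall x, -L <= x <= L -> f x = g x) ->
  int1 L f = int1 L g.
Proof.
by move=> fg; rewrite !int1E; apply: eq_Rintegral => x; rewrite inE /= in_itv /=; exact: fg.
Qed.

Lemma int1_cst L c : 0 <= L -> int1 L (fun=> c) = 2 * L * c.
Proof.
move=> L0; rewrite int1E Rintegral_cst// [X in fine X]lebesgue_measure_itv/= lte_fin.
case: ltP => LL.
  by rewrite -EFinD /= opprK; ring.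
have -> : L = 0 by lra.
by rewrite /= !mulr0 mul0r.
Qed.

Lemma le_int1 L f g : continuous f -> continuous g ->
  (forall x, -L <= x <= L -> f x <= g x) -> int1 L f <= int1 L g.
Proof.
move=> cf cg fg; rewrite !int1E; apply: le_Rintegral; [by []|exact: integrable_itv..|].
by move=> x /=; rewrite in_itv /=; exact: fg.
Qed.

Lemma int1_ge0 L f : (forall x, -L <= x <= L -> 0 <= f x) -> 0 <= int1 L f.
Proof.
by move=> f0; rewrite int1E; apply: Rintegral_ge0 => x /=; rewrite in_itv /=; exact: f0.
Qed.

Lemma subset_Rintegral_itv (a b c d : R) g : continuous g ->
  (forall x, 0 <= g x) -> c <= a -> b <= d ->
  (\int[mu]_(x in `[a, b]) g x <= \int[mu]_(x in `[c, d]) g x)%R.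
Proof.
move=> cg g0 ca bd; rewrite /Rintegral fine_le //.
- apply: integrable_fin_num => //; exact: integrable_itv.
- apply: integrable_fin_num => //; exact: integrable_itv.
- apply: ge0_subset_integral => //=.
  + have /integrableP[] := @integrable_itv c d g cg; by [].
  + by move=> x _; rewrite lee_fin.
  + by apply: subset_itv; rewrite bnd_simp.
Qed.

Lemma int1_mono L M g : continuous g -> (forall x, 0 <= g x) -> L <= M ->
  int1 L g <= int1 M g.
Proof. by move=> cg g0 LM; rewrite !int1E; apply: subset_Rintegral_itv => //; lra. Qed.

Lemma derive_continuous (F g : R -> R) :
  (forall x : R, is_derive x 1 F (g x)) -> continuous F.
Proof.
move=> dF x; apply/differentiable_continuous/derivable1_diffP.
by have [] := dF x.
Qed.

Lemma Rintegral_FTC (a b : R) (F g : R -> R) : a < b ->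
  (forall x : R, is_derive x 1 F (g x)) -> continuous g ->
  (\int[mu]_(x in `[a, b]) g x)%R = F b - F a.
Proof.
move=> ab dF cg; have cF := derive_continuous dF.
rewrite /Rintegral (@continuous_FTC2 _ g F) //.
- exact: continuous_subspaceT.
- split.
  + by move=> x _; have [] := dF x.
  + exact/cvg_at_right_filter/cF.
  + exact/cvg_at_left_filter/cF.
- by move=> x _; rewrite derive1E; apply: derive_val.
Qed.

Lemma int1_FTC L (F g : R -> R) : 0 < L ->
  (forall x : R, is_derive x 1 F (g x)) -> continuous g ->
  int1 L g = F L - F (- L).
Proof. by move=> L0 dF cg; rewrite int1E; apply: Rintegral_FTC => //; lra. Qed.

(** Valid for any two points of the segment, with the integral taken over the whole
    of it: the bound is therefore uniform in both points, which is how suprema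
    over a segment are controlled below. *)
Lemma osc_le_int1 L (F g : R -> R) x y :
  (forall x : R, is_derive x 1 F (g x)) -> continuous g ->
  - L <= x <= L -> - L <= y <= L -> `|F x - F y| <= int1 L (fun t => `|g t|).
Proof.
move=> dF cg; wlog : x y / x < y.
  move=> H xL yL; case: (ltgtP x y) => [xy|xy|->]; first exact: H.
  - by rewrite distrC; exact: H.
  - by rewrite subrr normr0; apply: int1_ge0.
move=> xy /andP[Lx xL] /andP[Ly yL].
rewrite int1E distrC -(Rintegral_FTC xy dF cg).
apply: le_trans (le_normr_Rintegral _ _) _ => //; first exact: integrable_itv.
by apply: subset_Rintegral_itv => //; exact: continuous_normr.
Qed.

Lemma int1_eq0 L g : continuous g -> (forall x, 0 <= g x) -> int1 L g <= 0 ->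
  forall x, - L < x < L -> g x = 0.
Proof.
move=> cg g0 intg x /andP[Lx xL]; apply/eqP/negPn/negP => gx0.
have gx : 0 < g x / 2 by rewrite divr_gt0 // lt_neqAle eq_sym gx0 g0.
have /cvgrPdist_lt /(_ _ gx) := cg x.
move=> /nbhs_ballP[e /= e0 he].
pose d := Num.min (e / 2) (Num.min (L - x) (x + L)).
have d0 : 0 < d by rewrite !lt_min; apply/andP; split; [lra|apply/andP; split; lra].
have de : d <= e / 2 by rewrite /d ge_min lexx.
have dL1 : d <= L - x by rewrite /d !ge_min lexx orbT.
have dL2 : d <= x + L by rewrite /d !ge_min lexx !orbT.
suff : 0 < int1 L g by rewrite ltNge intg.
rewrite int1E.
have H : (\int[mu]_(t in `[x - d, x + d]) (g x / 2) <=
          \int[mu]_(t in `[x - d, x + d]) g t)%R.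
  apply: le_Rintegral => //.
  - by apply: integrable_itv => ?; exact: cvg_cst.
  - exact: integrable_itv.
  - move=> t /=; rewrite in_itv /= => /andP[t1 t2].
    have /he : ball x e t by rewrite /ball /= ltr_norml; apply/andP; split; lra.
    rewrite /= ltr_norml => /andP[_]; lra.
apply: lt_le_trans (le_trans H (subset_Rintegral_itv _ _ _ _)) => //; try lra.
rewrite Rintegral_cst// [X in fine X]lebesgue_measure_itv /= lte_fin ifT; last lra.
rewrite -EFinD /= mulr_gt0 //; lra.
Qed.

End Integral1.

(** * Iterated integrals over squares and partial derivatives *)

Section Continuity2.
Variable R : realType.
Implicit Types (f g : R -> R -> R) (L : R).
Local Notation mu := (@lebesgue_measure R).

(** Functions of the plane are curried, so that exchanging the two coordinates is
    [flip] and every estimate in one direction yields its mirror image. *)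
Definition cont2 f := continuous (fun z : R * R => f z.1 z.2).

Definition flip f : R -> R -> R := fun x y => f y x.

Lemma cont2_comp f (u v : R * R -> R) : cont2 f -> continuous u ->
  continuous v -> continuous (fun z => f (u z) (v z)).
Proof.
move=> cf cu cv z.
apply: (@continuous_comp _ _ _ (fun z => (u z, v z)) (fun z => f z.1 z.2)).
  exact: (cvg_pair (cu z) (cv z)).
exact: cf.
Qed.

Lemma cont2_flip f : cont2 f -> cont2 (flip f).
Proof.
move=> cf; by apply: (cont2_comp cf) => z; [exact: cvg_snd|exact: cvg_fst].
Qed.

Lemma cont2_slice2 f x : cont2 f -> continuous (f x).
Proof.
move=> cf y.
apply: (@continuous_comp _ _ _ (fun y => (x, y)) (fun z => f z.1 z.2)).
  exact: (cvg_pair (cvg_cst _) cvg_id).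
exact: cf.
Qed.

Lemma cont2_slice1 f y : cont2 f -> continuous (f^~ y).
Proof. by move=> cf; exact: (@cont2_slice2 (flip f) y (cont2_flip cf)). Qed.

Lemma cont2_cst c : cont2 (fun _ _ => c).
Proof. by move=> z; exact: cvg_cst. Qed.

Lemma cont2_fst (g : R -> R) : continuous g -> cont2 (fun x _ => g x).
Proof.
move=> cg z; apply: (@continuous_comp _ _ _ fst g); last exact: cg.
exact: cvg_fst.
Qed.

Lemma cont2_snd (g : R -> R) : continuous g -> cont2 (fun _ y => g y).
Proof. by move=> cg; apply: cont2_flip; exact: (cont2_fst cg). Qed.

Lemma cont2D f g : cont2 f -> cont2 g -> cont2 (fun x y => f x y + g x y).
Proof. by move=> cf cg z; apply: cvgD; [exact: cf|exact: cg]. Qed.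

Lemma cont2N f : cont2 f -> cont2 (fun x y => - f x y).
Proof. by move=> cf z; apply: cvgN; exact: cf. Qed.

Lemma cont2M f g : cont2 f -> cont2 g -> cont2 (fun x y => f x y * g x y).
Proof. by move=> cf cg z; apply: cvgM; [exact: cf|exact: cg]. Qed.

Lemma cont2X f n : cont2 f -> cont2 (fun x y => f x y ^+ n).
Proof.
move=> cf; elim: n => [|n IH].
  by move=> z; under eq_fun do rewrite expr0; exact: cvg_cst.
by move=> z; under eq_fun do rewrite exprS; exact: (cont2M cf IH).
Qed.

Lemma cont2_norm f : cont2 f -> cont2 (fun x y => `|f x y|).
Proof. by move=> cf z; apply: cvg_norm; exact: cf. Qed.

Lemma cont2_post (h : R -> R) f : continuous h -> cont2 f ->
  cont2 (fun x y => h (f x y)).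
Proof.
move=> ch cf z.
by apply: (@continuous_comp _ _ _ (fun z => f z.1 z.2) h); [exact: cf|exact: ch].
Qed.

Lemma cont2_bounded f (a b c d : R) : cont2 f ->
  exists2 M, 0 <= M & forall x y, a <= x <= b -> c <= y <= d -> `|f x y| <= M.
Proof.
move=> cf.
have /compact_bounded[M [_ HM]] : compact
    ((fun z : R * R => f z.1 z.2) @` (`[a, b] `*` `[c, d])).
  apply: continuous_compact; first exact: continuous_subspaceT.
  by apply: compact_setX; exact: segment_compact.
exists (`|M| + 1); first by rewrite addr_ge0.
move=> x y xab ycd; apply: (HM (`|M| + 1)); first by rewrite ltr_pwDr ?ler_norm.
by exists (x, y) => //=; split; rewrite /= in_itv.
Qed.

Lemma continuous_int1 L f : cont2 f ->
  continuous (fun y => int1 L (fun x => f x y)).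
Proof.
move=> cf y.
rewrite (_ : (fun y => _) = fun y => (\int[mu]_(x in `[- L, L]) f x y)%R); last first.
  by apply/funext => t; exact: int1E.
have [M M0 HM] := @cont2_bounded f (- L) L (y - 1) (y + 1) cf.
have := @continuity_under_integral R _ _ mu (flip f) `[- L, L]%classic
  (measurable_itv _) (y - 1) (y + 1).
move=> /(_ _ _ (cst M)) H.
apply: H.
- by move=> t _; apply: integrable_itv; exact: cont2_slice1.
- by apply: aeW => t _ s _; exact: cont2_slice2.
- by apply: integrable_itv => ?; exact: cvg_cst.
- move=> t /=; rewrite in_itv /= => /andP[t1 t2]; apply: aeW => s /=.
  by rewrite in_itv /= => sL; apply: HM => //; lra.
- by rewrite inE /= in_itv /=; lra.
Qed.

(** The product sigma-algebra contains the open sets of the plane because an open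
    set is the countable union of the rational boxes that it contains. *)
Lemma open_prod_measurable (U : set (R * R)) : open U ->
  measurable (U : set (measurableTypeR R * measurableTypeR R)).
Proof.
move=> oU.
pose B (n : nat) (a b : rat) : set (measurableTypeR R * measurableTypeR R) :=
  `]ratr a - n.+1%:R^-1, ratr a + n.+1%:R^-1[ `*`
  `]ratr b - n.+1%:R^-1, ratr b + n.+1%:R^-1[.
have -> : U = \bigcup_n \bigcup_a \bigcup_b
    (if `[< B n a b `<=` U >] then B n a b else set0).
  apply/seteqP; split=> [z Uz|z [n _ [a _ [b _]]]]; last first.
    by case: asboolP => // BU /BU.
  have /nbhs_ballP[e /= e0 zeU] := open_nbhs_nbhs (conj oU Uz).
  have e2 : 0 < e / 2 by lra.
  have [n _ /(_ _ (leqnn n)) /= ne] := near_infty_natSinv_lt (PosNum e2).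
  have n0 : 0 < n.+1%:R^-1 :> R by rewrite invr_gt0.
  have near_rat (r : R) : exists a : rat,
      ratr a - n.+1%:R^-1 < r < ratr a + n.+1%:R^-1.
    have [|a] := @rat_in_itvoo R (r - n.+1%:R^-1) (r + n.+1%:R^-1).
      by rewrite ltrD2l gtrN.
    rewrite in_itv /= => /andP[h1 h2]; exists a.
    by rewrite ltrBlDr h2 -ltrBlDr h1.
  have [a za] := near_rat z.1; have [b zb] := near_rat z.2.
  exists n => //; exists a => //; exists b => //.
  case: asboolP => [_|]; first by rewrite /B; split; rewrite /= in_itv.
  case=> w [/=]; rewrite !in_itv /= => wa wb; apply: zeU.
  move: n0 ne wa wb za zb; set d := _^-1 => n0 ne wa wb za zb.
  by split; rewrite /ball /= ltr_norml; lra.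
apply: bigcupT_measurable => n; apply: bigcupT_measurable_rat => a.
apply: bigcupT_measurable_rat => b.
case: asboolP => _; last exact: measurable0.
by apply: measurableX; exact: measurable_itv.
Qed.

Lemma cont2_measurable f : cont2 f -> measurable_fun setT
  (fun z : measurableTypeR R * measurableTypeR R => f z.1 z.2).
Proof.
move=> cf; apply: (measurability _ (measurable_realfun.RGenOInfty.measurableE R)) => //.
move=> _ [_ [a ->] <-].
rewrite setTI; apply: open_prod_measurable.
by apply: open_comp => [z _|]; [exact: cf|rewrite set_itvE; exact: open_gt].
Qed.

Definition int2 L f : R := int1 L (fun y => int1 L (fun x => f x y)).

Lemma int2E L f : cont2 f -> int2 L f =
  fine (\int[mu]_(y in `[(- L)%R, L]) \int[mu]_(x in `[(- L)%R, L]) (f x y)%:E)%E.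
Proof.
move=> cf; rewrite /int2 int1E /Rintegral; congr fine.
apply: eq_integral => y _; rewrite int1E fineK //.
by apply: integrable_fin_num => //; apply: integrable_itv; exact: cont2_slice1.
Qed.

(** Fubini on a square: continuity makes the function measurable for the product
    sigma-algebra, and compactness makes it bounded. *)
Lemma int2_swap L f : cont2 f -> int2 L (flip f) = int2 L f.
Proof.
move=> cf.
pose I := `[- L, L]%classic : set R.
pose box : set (measurableTypeR R * measurableTypeR R) := I `*` I.
pose g := (fun z : measurableTypeR R * measurableTypeR R => (f z.1 z.2)%:E)
  \_ box.
have [M M0 HM] := @cont2_bounded f (- L) L (- L) L cf.
have mI : measurable (I : set (measurableTypeR R)) by exact: measurable_itv.
have mbox : measurable box by apply: measurableX.
have ig : (mu \x mu)%E.-integrable setT g.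
  apply/(integrable_mkcond _ mbox); apply: measurable_bounded_integrable => //.
  - have muI : (mu I < +oo)%E.
      by rewrite [X in (X < _)%E]lebesgue_measure_itv; case: ifP; rewrite ?ltry.
    rewrite [X in (X < _)%E]product_measure1E //.
    by rewrite lte_mul_pinfty ?ge0_fin_numE.
  - by apply: measurable_funTS; exact: cont2_measurable.
  - exists M; split; first exact: num_real.
    move=> r Mr [x y] [/=]; rewrite /I /= !in_itv /= => xI yI.
    exact: le_trans (HM _ _ xI yI) (ltW Mr).
have := Fubini ig.
rewrite (int2E _ cf) (int2E _ (cont2_flip cf)) /flip.
have gE x y : g (x, y) = if (x \in I) && (y \in I) then (f x y)%:E else 0%E.
  by rewrite /g patchE /box in_setX.
have -> : (\int[mu]_x \int[mu]_y g (x, y) =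
    \int[mu]_(x in I) \int[mu]_(y in I) (f x y)%:E)%E.
  rewrite [RHS]integral_mkcond; apply: eq_integral => x _; rewrite patchE.
  case: ifP => xI; last first.
    by apply: integral0_eq => y _; rewrite gE xI.
  rewrite [RHS]integral_mkcond; apply: eq_integral => y _.
  by rewrite gE xI patchE.
move=> ->; congr fine.
rewrite [RHS]integral_mkcond; apply: eq_integral => y _; rewrite patchE.
case: ifP => yI; last first.
  by apply: integral0_eq => x _; rewrite gE yI andbF.
rewrite [RHS]integral_mkcond; apply: eq_integral => x _.
by rewrite gE yI andbT patchE.
Qed.

Lemma int2D L f g : cont2 f -> cont2 g ->
  int2 L (fun x y => f x y + g x y) = int2 L f + int2 L g.
Proof.
move=> cf cg; rewrite /int2 -int1D; try exact: continuous_int1.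
by apply: eq_int1 => y _; rewrite int1D //; exact: cont2_slice1.
Qed.

Lemma int2Z L c f : cont2 f ->
  int2 L (fun x y => c * f x y) = c * int2 L f.
Proof.
move=> cf; rewrite /int2 -int1Z; last exact: continuous_int1.
by apply: eq_int1 => y _; rewrite int1Z //; exact: cont2_slice1.
Qed.

Lemma le_int2 L f g : cont2 f -> cont2 g ->
  (forall x y, -L <= x <= L -> -L <= y <= L -> f x y <= g x y) ->
  int2 L f <= int2 L g.
Proof.
move=> cf cg fg; apply: le_int1; try exact: continuous_int1.
move=> y yL; apply: le_int1; try exact: cont2_slice1.
by move=> x xL; exact: fg.
Qed.

Lemma int2_ge0 L f :
  (forall x y, -L <= x <= L -> -L <= y <= L -> 0 <= f x y) -> 0 <= int2 L f.
Proof.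
by move=> f0; apply: int1_ge0 => y yL; apply: int1_ge0 => x xL; exact: f0.
Qed.

Lemma int2_mono L M f : cont2 f -> (forall x y, 0 <= f x y) -> L <= M ->
  int2 L f <= int2 M f.
Proof.
move=> cf f0 LM; apply: (@le_trans _ _ (int1 L (fun y => int1 M (f^~ y)))).
  apply: le_int1; try exact: continuous_int1.
  by move=> y _; apply: int1_mono => //; exact: cont2_slice1.
apply: int1_mono => //; first exact: continuous_int1.
by move=> y; exact: int1_ge0.
Qed.

Lemma int2_eq0 L f : cont2 f -> (forall x y, 0 <= f x y) -> int2 L f <= 0 ->
  forall x y, - L < x < L -> - L < y < L -> f x y = 0.
Proof.
move=> cf f0 If x y xL yL.
apply: (@int1_eq0 _ L (f^~ y)) => //; first exact: cont2_slice1.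
rewrite (@int1_eq0 _ L (fun y => int1 L (f^~ y)) _ _ If) //.
  exact: continuous_int1.
by move=> z; exact: int1_ge0.
Qed.

Definition D1 f g := forall x y : R, is_derive x 1 (f^~ y) (g x y).
Definition D2 f g := forall x y : R, is_derive y 1 (f x) (g x y).

Lemma D1_flip f g : D1 f g -> D2 (flip f) (flip g).
Proof. by move=> df x y; exact: df. Qed.

Lemma D2_flip f g : D2 f g -> D1 (flip f) (flip g).
Proof. by move=> df x y; exact: df. Qed.

(** With its mirror image, the divergence theorem for vector fields whose normal
    component vanishes on the boundary of the square. *)
Lemma int2_D1_eq0 L F g : 0 < L -> D1 F g -> cont2 g ->
  (forall y, F L y = 0) -> (forall y, F (- L) y = 0) -> int2 L g = 0.
Proof.
move=> L0 dF cg F0 F1; rewrite /int2 -(mulr0 (2 * L)) -(@int1_cst _ L 0 (ltW L0)).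
apply: eq_int1 => y _.
by rewrite (int1_FTC L0 (dF^~ y) (cont2_slice1 cg)) F0 F1 subrr.
Qed.

Lemma int2_D2_eq0 L F g : 0 < L -> D2 F g -> cont2 g ->
  (forall x, F x L = 0) -> (forall x, F x (- L) = 0) -> int2 L g = 0.
Proof.
move=> L0 dF cg F0 F1; rewrite -int2_swap //.
exact: (@int2_D1_eq0 L (flip F)) (D2_flip dF) (cont2_flip cg) F0 F1.
Qed.

End Continuity2.

(** * Rules for partial derivatives, and the cut-off function *)

Section PartialRules.
Variable R : realType.
Implicit Types (f g F : R -> R -> R).

Lemma D1_ext f g g' : D1 f g -> (forall x y, g x y = g' x y) -> D1 f g'.
Proof. by move=> df gg' x y; rewrite -gg'; exact: df. Qed.

Lemma D1D f f1 g g1 : D1 f f1 -> D1 g g1 ->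
  D1 (fun x y => f x y + g x y) (fun x y => f1 x y + g1 x y).
Proof. by move=> df dg x y; exact: is_deriveD (df x y) (dg x y). Qed.

Lemma D1N f f1 : D1 f f1 -> D1 (fun x y => - f x y) (fun x y => - f1 x y).
Proof. by move=> df x y; exact: is_deriveN (df x y). Qed.

Lemma D1M f f1 g g1 : D1 f f1 -> D1 g g1 ->
  D1 (fun x y => f x y * g x y) (fun x y => f1 x y * g x y + f x y * g1 x y).
Proof.
move=> df dg x y.
apply: is_derive_eq (is_deriveM (df x y) (dg x y)) _.
by rewrite addrC /GRing.scale /= mulrC.
Qed.

Lemma D1_fst (g g' : R -> R) : (forall x : R, is_derive x 1 g (g' x)) ->
  D1 (fun x _ => g x) (fun x _ => g' x).
Proof. by move=> dg x y; exact: dg. Qed.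

Lemma D1_snd (g : R -> R) : D1 (fun _ y => g y) (fun _ _ => 0).
Proof. by move=> x y; exact: is_derive_cst. Qed.

Lemma D1_comp (h h1 : R -> R) f f1 :
  (forall x : R, is_derive x 1 h (h1 x)) -> D1 f f1 ->
  D1 (fun x y => h (f x y)) (fun x y => h1 (f x y) * f1 x y).
Proof.
move=> dh df x y.
apply: is_derive_eq (is_derive1_comp (dh (f x y)) (df x y)) _.
by rewrite mulrC.
Qed.

Lemma D2_ext f g g' : D2 f g -> (forall x y, g x y = g' x y) -> D2 f g'.
Proof. by move=> df gg' x y; rewrite -gg'; exact: df. Qed.

Lemma D2D f f1 g g1 : D2 f f1 -> D2 g g1 ->
  D2 (fun x y => f x y + g x y) (fun x y => f1 x y + g1 x y).
Proof. by move=> df dg x y; exact: is_deriveD (df x y) (dg x y). Qed.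

Lemma D2N f f1 : D2 f f1 -> D2 (fun x y => - f x y) (fun x y => - f1 x y).
Proof. by move=> df x y; exact: is_deriveN (df x y). Qed.

Lemma D2M f f1 g g1 : D2 f f1 -> D2 g g1 ->
  D2 (fun x y => f x y * g x y) (fun x y => f1 x y * g x y + f x y * g1 x y).
Proof.
by move=> /D2_flip df /D2_flip dg; exact: (D1_flip (D1M df dg)).
Qed.

Lemma D2_snd (g g' : R -> R) : (forall x : R, is_derive x 1 g (g' x)) ->
  D2 (fun _ y => g y) (fun _ y => g' y).
Proof. by move=> dg x y; exact: dg. Qed.

Lemma D2_fst (g : R -> R) : D2 (fun x _ => g x) (fun _ _ => 0).
Proof. by move=> x y; exact: is_derive_cst. Qed.

Lemma D2_comp (h h1 : R -> R) f f1 :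
  (forall x : R, is_derive x 1 h (h1 x)) -> D2 f f1 ->
  D2 (fun x y => h (f x y)) (fun x y => h1 (f x y) * f1 x y).
Proof.
by move=> dh /D2_flip df; exact: (D1_flip (D1_comp dh df)).
Qed.

Lemma D12_cst f : D1 f (fun _ _ => 0) -> D2 f (fun _ _ => 0) ->
  forall x y, f x y = f 0 0.
Proof.
have H (g : R -> R) : (forall x : R, is_derive x 1 g 0) ->
    forall x, g x = g 0.
  move=> dg x; apply/eqP; rewrite -subr_eq0 -normr_le0.
  have := @osc_le_int1 _ (`|x|) g (fun=> 0) x 0 dg.
  rewrite -/(cst _) int1_cst // normr0 mulr0; apply.
  - by move=> ?; exact: cvg_cst.
  - by rewrite -ler_norml.
  - by rewrite oppr_le0 !normr_ge0.
move=> d1 d2 x y.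
by rewrite (H (f x) (fun t => d2 x t) y) (H (f^~ 0) (fun t => d1 t 0) x).
Qed.

End PartialRules.

Section CutoffFun.
Variable R : realType.
Variable l : R.
Implicit Types t : R.

(** A polynomial that vanishes to second order at [1 / l] and [- 1 / l]; on that
    segment it is the cut-off function of the energy estimate. Being a square, it
    has a derivative controlled by its own square root. *)
Definition cutoff t : R := (1 - (t * l) ^+ 2) ^+ 2.
Definition cutoff1 t : R := - 4 * (t * l) * l * (1 - (t * l) ^+ 2).
Definition cutoff2 t : R := - 4 * l ^+ 2 + 12 * (t * l) ^+ 2 * l ^+ 2.

Lemma is_derive_cutoff t : is_derive t 1 cutoff (cutoff1 t).
Proof.
rewrite /cutoff; apply: is_derive_eq.
rewrite /GRing.scale /= /cutoff1; ring.
Qed.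

Lemma is_derive_cutoff1 t : is_derive t 1 cutoff1 (cutoff2 t).
Proof.
rewrite /cutoff1; apply: is_derive_eq.
rewrite /GRing.scale /= /cutoff2; ring.
Qed.

Lemma continuous_cutoff2 : continuous cutoff2.
Proof.
apply: (@derive_continuous _ _ (fun t => 24 * (t * l) * l ^+ 3)) => t.
rewrite /cutoff2; apply: is_derive_eq.
rewrite /GRing.scale /=; ring.
Qed.

End CutoffFun.

(** * Convex profiles, growth of the drift, and the energy identity *)

(** The smooth convex substitute for [|s| ^ q]. Two properties drive the proof:
    [profile_lin] converts bounds on the integral of [h] into bounds on integrals
    over long segments, and [profile_sqr], which makes [h] grow like a power
    larger than one, lets first order terms be absorbed by the energy density
    [h'' (f) |grad f| ^ 2]. *)
Record convex_profile (R : realType) (h h1 h2 : R -> R) (C0 : R) : Prop := {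
  profile_d1 : forall s : R, is_derive s 1 h (h1 s);
  profile_d2 : forall s : R, is_derive s 1 h1 (h2 s);
  profile_c2 : continuous h2;
  profile_ge0 : forall s, 0 <= h s;
  profile_h2_ge0 : forall s, 0 <= h2 s;
  profile_C0_ge0 : 0 <= C0;
  profile_sqr : forall s, h1 s ^+ 2 <= C0 * h s * h2 s;
  profile_lin : forall s, `|s| <= 1 + h s;
  profile_eq0 : forall s, h s = 0 -> s = 0
}.

Ltac cont2_tac := repeat first [ match goal with
  | |- cont2 (fun _ _ => ?c) => exact: (@cont2_cst _ c)
  | |- cont2 (fun x y => @?F x y + @?G x y) => apply: (@cont2D _ F G)
  | |- cont2 (fun x y => - @?F x y) => apply: (@cont2N _ F)
  | |- cont2 (fun x y => @?F x y * @?G x y) => apply: (@cont2M _ F G)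
  | |- cont2 (fun x y => @?F x y ^+ ?n) => apply: (@cont2X _ F n)
  | |- cont2 (fun x y => `|@?F x y|) => apply: (@cont2_norm _ F)
  end | assumption | match goal with
  | |- cont2 (fun x y => @?F x) => apply: (@cont2_fst _ F)
  | |- cont2 (fun x y => @?G y) => apply: (@cont2_snd _ G)
  end ].

Ltac D1_tac := repeat first
  [eassumption | eapply D1_snd | eapply D1D | eapply D1N | eapply D1M].

Ltac D2_tac := repeat first
  [eassumption | eapply D2_fst | eapply D2D | eapply D2N | eapply D2M].

Section Energy.
Variables (R : realType) (h h1 h2 : R -> R) (C0 : R).
Hypothesis hp : convex_profile h h1 h2 C0.

Let dh := profile_d1 hp.
Let dh1 := profile_d2 hp.
Let ch2 := profile_c2 hp.
Let h_ge0 := profile_ge0 hp.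
Let h2_ge0 := profile_h2_ge0 hp.
Let C0_ge0 := profile_C0_ge0 hp.

Lemma continuous_profile : continuous h.
Proof. exact: (derive_continuous dh). Qed.
Lemma continuous_profile1 : continuous h1.
Proof. exact: (derive_continuous dh1). Qed.

(** Sobolev embedding gives no pointwise bound on [b] for small exponents. Moving
    from [(x, y)] along the horizontal line to a point [(s, y)] with [|s| <= 1],
    then vertically to [(s, 0)], costs two integrals of partial derivatives, and
    [|d| <= 1 + h d] bounds each by its length plus an integral of [h]. The vertical one
    is averaged over [s] and becomes part of the constant; the horizontal one
    stays, but it depends on [y] alone and its integral in [y] is bounded. *)
Lemma profile_growth (b b1 b2 : R -> R -> R) K :
  cont2 b -> D1 b b1 -> D2 b b2 -> cont2 b1 -> cont2 b2 ->
  (forall L, 0 < L -> int2 L (fun x y => h (b2 x y)) <= K) ->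
  exists2 C, 0 <= C & forall L x y, 1 <= L -> - L <= x <= L -> - L <= y <= L ->
    `|b x y| <= C * L + int1 L (fun t => h (b1 t y)).
Proof.
move=> cb db1 db2 cb1 cb2 HK.
have ch := continuous_profile.
have chb1 := cont2_post ch cb1; have chb2 := cont2_post ch cb2.
have cnb : continuous (fun s => `|b s 0|).
  by apply: continuous_normr; exact: cont2_slice1.
pose M := int1 1 (fun s => `|b s 0|).
have M0 : 0 <= M by apply: int1_ge0.
have K0 : 0 <= K by apply: le_trans (HK 1 ltr01); apply: int2_ge0.
exists (M / 2 + 4 + K / 2); first by rewrite !addr_ge0 // divr_ge0.
move=> L x y L1 xL yL.
have L0 : 0 < L by lra.
set G := int1 L (fun t => h (b1 t y)).
have abs_le_lin (g : R -> R) : continuous g ->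
    int1 L (fun t => `|g t|) <= 2 * L + int1 L (fun t => h (g t)).
  move=> cg; have chg : continuous (h \o g).
    by move=> t; apply: continuous_comp; [exact: cg|exact: ch].
  rewrite -[2 * L]mulr1 -(@int1_cst _ L 1 (ltW L0)) -int1D //; last first.
    by move=> ?; exact: cvg_cst.
  apply: le_int1.
  - exact: continuous_normr.
  - by move=> t; apply: cvgD; [exact: cvg_cst|exact: chg].
  - by move=> t _; exact: profile_lin hp _.
(* the path (x, y) - (s, y) - (s, 0) *)
have Hs s : -1 <= s <= 1 ->
    `|b x y| <= `|b s 0| + (4 * L + G) + int1 L (fun t => h (b2 s t)).
  move=> s1.
  have H1 : `|b x y - b s y| <= 2 * L + G.
    apply: le_trans (osc_le_int1 (db1^~ y) _ xL _) _; try lra.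
      exact: cont2_slice1.
    by apply: abs_le_lin; exact: cont2_slice1.
  have H2 : `|b s y - b s 0| <= 2 * L + int1 L (fun t => h (b2 s t)).
    apply: le_trans (osc_le_int1 (db2 s) _ yL _) _; try lra.
      exact: cont2_slice2.
    by apply: abs_le_lin; exact: cont2_slice2.
  have := ler_normD (b x y - b s y) (b s y - b s 0).
  have := ler_normD (b x y - b s 0) (b s 0).
  rewrite subrK addrA subrK; lra.
have cI : continuous (fun s => int1 L (fun t => h (b2 s t))).
  exact: (@continuous_int1 _ L (fun t s => h (b2 s t)) (cont2_flip chb2)).
have ccst (c : R) : continuous (fun _ : R => c) by move=> ?; exact: cvg_cst.
have cD (u v : R -> R) : continuous u -> continuous v ->
    continuous (fun s => u s + v s).
  by move=> cu cv s; apply: cvgD; [exact: cu|exact: cv].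
have := le_int1 (ccst `|b x y|) (cD _ _ (cD _ _ cnb (ccst (4 * L + G))) cI) Hs.
rewrite int1_cst // int1D ?int1D ?int1_cst //; last exact: cD.
have : int1 1 (fun s => int1 L (fun t => h (b2 s t))) <= K.
  apply: le_trans (HK L L0); rewrite -int2_swap //.
  by apply: int1_mono => // s; exact: int1_ge0.
have : M <= M * L by rewrite ler_peMr.
have : K <= K * L by rewrite ler_peMr.
rewrite -/M !mulrDl; lra.
Qed.

Section Identity.
Variables (f f1 f2 f11 f22 b1 b2 b11 b22 : R -> R -> R).
Hypothesis cf : cont2 f.
Hypotheses (df1 : D1 f f1) (df2 : D2 f f2).
Hypotheses (df11 : D1 f1 f11) (df22 : D2 f2 f22).
Hypotheses (cf1 : cont2 f1) (cf2 : cont2 f2).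
Hypotheses (cf11 : cont2 f11) (cf22 : cont2 f22).
Hypotheses (cb1 : cont2 b1) (cb2 : cont2 b2).
Hypotheses (db11 : D1 b1 b11) (db22 : D2 b2 b22).
Hypotheses (cb11 : cont2 b11) (cb22 : cont2 b22).
Hypothesis div0 : forall x y, b11 x y + b22 x y = 0.
Hypothesis eqn : forall x y, f11 x y + f22 x y = b1 x y * f1 x y + b2 x y * f2 x y.

Let ch := continuous_profile.
Let ch1 := continuous_profile1.
Let chf : cont2 (fun x y => h (f x y)). Proof. exact: cont2_post. Qed.
Let ch1f : cont2 (fun x y => h1 (f x y)). Proof. exact: cont2_post. Qed.
Let ch2f : cont2 (fun x y => h2 (f x y)). Proof. exact: cont2_post. Qed.

Variables (L : R) (z z1 z2 : R -> R).
Hypothesis L_gt0 : 0 < L.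
Hypothesis dz : forall x : R, is_derive x 1 z (z1 x).
Hypothesis dz1 : forall x : R, is_derive x 1 z1 (z2 x).
Hypothesis cz2 : continuous z2.
Hypotheses (zL : z L = 0) (zNL : z (- L) = 0).
Hypotheses (z1L : z1 L = 0) (z1NL : z1 (- L) = 0).
Let cz : continuous z. Proof. exact: (derive_continuous dz). Qed.
Let cz1 : continuous z1. Proof. exact: (derive_continuous dz1). Qed.

(** Test the equation for [f] with [h' (f)] times the cut-off. The drift is free of
    divergence, so only its product with the gradient of the cut-off survives. As a
    formula: the divergence of [eta h'(f) grad f - h(f) grad eta - h(f) eta b] is
    [eta h''(f) |grad f|^2 - h(f) (Laplacian eta + b . grad eta)]. *)
Lemma energy_identity :
  int2 L (fun x y => z x * z y * h2 (f x y) * (f1 x y ^+ 2 + f2 x y ^+ 2)) =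
  int2 L (fun x y => h (f x y) * (z2 x * z y + z x * z2 y +
    (b1 x y * z1 x * z y + b2 x y * z x * z1 y))).
Proof.
pose F1 x y := z x * z y * (h1 (f x y) * f1 x y - h (f x y) * b1 x y)
   - h (f x y) * z1 x * z y.
pose F2 x y := z x * z y * (h1 (f x y) * f2 x y - h (f x y) * b2 x y)
   - h (f x y) * z x * z1 y.
pose G1 x y := z1 x * z y * (h1 (f x y) * f1 x y - h (f x y) * b1 x y)
  + z x * z y * (h2 (f x y) * f1 x y ^+ 2 + h1 (f x y) * f11 x y
       - h1 (f x y) * f1 x y * b1 x y - h (f x y) * b11 x y)
  - h1 (f x y) * f1 x y * z1 x * z y - h (f x y) * z2 x * z y.
pose G2 x y := z x * z1 y * (h1 (f x y) * f2 x y - h (f x y) * b2 x y)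
  + z x * z y * (h2 (f x y) * f2 x y ^+ 2 + h1 (f x y) * f22 x y
       - h1 (f x y) * f2 x y * b2 x y - h (f x y) * b22 x y)
  - h1 (f x y) * f2 x y * z x * z1 y - h (f x y) * z x * z2 y.
have dF1 : D1 F1 G1.
  have dhf := D1_comp dh df1; have dh1f := D1_comp dh1 df1.
  have dzx := D1_fst dz; have dz1x := D1_fst dz1.
  rewrite /F1; eapply D1_ext; [D1_tac|by move=> x y; rewrite /G1 /=; ring].
have dF2 : D2 F2 G2.
  have dhf := D2_comp dh df2; have dh1f := D2_comp dh1 df2.
  have dzy := D2_snd dz; have dz1y := D2_snd dz1.
  rewrite /F2; eapply D2_ext; [D2_tac|by move=> x y; rewrite /G2 /=; ring].
have cG1 : cont2 G1 by rewrite /G1; cont2_tac.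
have cG2 : cont2 G2 by rewrite /G2; cont2_tac.
have I1 : int2 L G1 = 0.
  apply: int2_D1_eq0 dF1 cG1 _ _ => // y.
    by rewrite /F1 zL z1L; ring.
  by rewrite /F1 zNL z1NL; ring.
have I2 : int2 L G2 = 0.
  apply: int2_D2_eq0 dF2 cG2 _ _ => // y.
    by rewrite /F2 zL z1L; ring.
  by rewrite /F2 zNL z1NL; ring.
have cR : cont2 (fun x y => h (f x y) * (z2 x * z y + z x * z2 y +
    (b1 x y * z1 x * z y + b2 x y * z x * z1 y))) by cont2_tac.
rewrite -[RHS]addr0 -{1}I1 -(int2D L cR cG1) -[RHS]addr0 -I2.
rewrite -(int2D L (cont2D cR cG1) cG2).
congr int2; apply/funext => x; apply/funext => y; rewrite /G1 /G2.
have -> : b22 x y = - b11 x y by apply/eqP; rewrite -addr_eq0 addrC div0.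
have -> : f22 x y = b1 x y * f1 x y + b2 x y * f2 x y - f11 x y.
  by rewrite -eqn; ring.
by ring.
Qed.

End Identity.
End Energy.

(** * The drift term *)

Section CutoffBounds.
Variables (R : realType) (L x : R).
Hypotheses (L0 : 0 < L) (xL : - L <= x <= L).

Let tau_le1 : `|x * L^-1| <= 1.
Proof. by rewrite normrM normfV (gtr0_norm L0) ler_pdivrMr // mul1r ler_norml. Qed.

Let a_ge0 : 0 <= 1 - (x * L^-1) ^+ 2.
Proof. by rewrite subr_ge0 -real_normK ?num_real // exprn_ile1. Qed.

Let a_le1 : 1 - (x * L^-1) ^+ 2 <= 1.
Proof. by rewrite lerBlDr lerDl sqr_ge0. Qed.

Lemma cutoff_ge0 : 0 <= cutoff L^-1 x. Proof. exact: sqr_ge0. Qed.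

Lemma cutoff_le1 : cutoff L^-1 x <= 1. Proof. exact: exprn_ile1. Qed.

Let norm_cutoff1 : `|cutoff1 L^-1 x| =
  4 * L^-1 * (`|x * L^-1| * (1 - (x * L^-1) ^+ 2)).
Proof.
rewrite /cutoff1 !normrM (ger0_norm a_ge0) normrN (gtr0_norm (_ : 0 < L^-1)).
  by rewrite normr_nat; ring.
by rewrite invr_gt0.
Qed.

Lemma norm_cutoff1_le_x : `|cutoff1 L^-1 x| <= 4 * L^-1 * (`|x| / L).
Proof.
have l0 : 0 < L^-1 by rewrite invr_gt0.
rewrite norm_cutoff1 ler_pM2l; last by rewrite mulr_gt0.
have -> : `|x| / L = `|x * L^-1| by rewrite normrM (gtr0_norm l0).
by rewrite ler_piMr.
Qed.

Lemma norm_cutoff1_le_sqrt :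
  `|cutoff1 L^-1 x| <= 4 * L^-1 * (1 - (x * L^-1) ^+ 2).
Proof.
rewrite norm_cutoff1 ler_pM2l; last by rewrite mulr_gt0 ?invr_gt0.
by rewrite ler_piMl.
Qed.

Lemma norm_cutoff1_le : `|cutoff1 L^-1 x| <= 4 * L^-1.
Proof.
apply: le_trans norm_cutoff1_le_sqrt _.
by rewrite ler_piMr // mulr_ge0 // invr_ge0 ltW.
Qed.

Lemma norm_cutoff2_le : `|cutoff2 L^-1 x| <= 8 * L^-1 ^+ 2.
Proof.
have s0 : 0 <= (x * L^-1) ^+ 2 by exact: sqr_ge0.
rewrite (_ : cutoff2 _ _ = (12 * (x * L^-1) ^+ 2 - 4) * L^-1 ^+ 2); last first.
  by rewrite /cutoff2; ring.
rewrite normrM (ger0_norm (sqr_ge0 (L^-1))) ler_wpM2r ?sqr_ge0 //.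
by rewrite ler_norml; move: a_ge0 s0; set s := _ ^+ 2 => *; lra.
Qed.

End CutoffBounds.

Section Estimate.
Variables (R : realType) (h h1 h2 : R -> R) (C0 : R).
Hypothesis hp : convex_profile h h1 h2 C0.
Let dh := profile_d1 hp.
Let dh1 := profile_d2 hp.
Let ch2 := profile_c2 hp.
Let h_ge0 := profile_ge0 hp.
Let h2_ge0 := profile_h2_ge0 hp.
Let C0_ge0 := profile_C0_ge0 hp.
Let ch := continuous_profile hp.
Let ch1 := continuous_profile1 hp.

Lemma profile_young s d a : 0 <= a ->
  a * `|h1 s * d| <= (C0 * h s + a ^+ 2 * h2 s * d ^+ 2) / 2.
Proof.
move=> a0; set P := C0 * h s; set Q := a ^+ 2 * h2 s * d ^+ 2.
have P0 : 0 <= P by rewrite mulr_ge0.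
have Q0 : 0 <= Q by rewrite mulr_ge0 ?sqr_ge0 // mulr_ge0 ?sqr_ge0.
set X := a * _; have X0 : 0 <= X by rewrite mulr_ge0.
have XPQ : X ^+ 2 <= P * Q.
  have -> : X ^+ 2 = h1 s ^+ 2 * (a ^+ 2 * d ^+ 2).
    by rewrite /X exprMn real_normK ?num_real // exprMn; ring.
  have -> : P * Q = C0 * h s * h2 s * (a ^+ 2 * d ^+ 2) by rewrite /P /Q; ring.
  rewrite ler_wpM2r //; last exact: profile_sqr hp s.
  by apply: mulr_ge0; exact: sqr_ge0.
rewrite -(@ler_pXn2r _ 2) ?nnegrE //; last by rewrite divr_ge0 // addr_ge0.
apply: le_trans XPQ _.
rewrite -subr_ge0 (_ : _ - _ = ((P - Q) / 2) ^+ 2) ?sqr_ge0 //.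
by field.
Qed.

(** The part [C L] of the bound on [b] meets a derivative of the cut-off of size
    [|x| / L ^ 2], whence the first term. The other part [G] is only integrable in
    [y], so the horizontal integrals of the weight that multiplies it are bounded
    uniformly in [y]: the weight vanishes at [y = - L], hence it is at most the
    integral of its vertical derivative. That derivative carries a factor
    [1 / L], and by [profile_young] it costs [1 / L] times the energy, which is
    absorbed for large [L]. *)
Lemma drift_estimate (f f2 b g : R -> R -> R) (C K L : R) :
  cont2 f -> D2 f f2 -> cont2 f2 -> cont2 b -> cont2 g ->
  (forall x y, 0 <= g x y) -> 1 <= L -> 0 <= C -> 0 <= K ->
  (forall x y, - L <= x <= L -> - L <= y <= L ->
     `|b x y| <= C * L + int1 L (fun t => g t y)) ->
  int2 L (fun x y => h (f x y)) <= K -> int2 L g <= K ->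
  int2 L (fun x y => h (f x y) * `|b x y| * (`|cutoff1 L^-1 x| * cutoff L^-1 y))
  <= 4 * C * int2 L (fun x y => h (f x y) * (`|x| / L)) +
     K * (L^-1 * (2 * C0 * K + 16 * K) + 2 * L^-1 * int2 L (fun x y =>
       cutoff L^-1 x * cutoff L^-1 y * h2 (f x y) * f2 x y ^+ 2)).
Proof.
move=> cf df2 cf2 cb cg g0 L1 C_ge0 K0 bC hfK gK.
have L0 : 0 < L by lra.
have l0 : 0 < L^-1 by rewrite invr_gt0.
have l1 : L^-1 <= 1 by rewrite invf_le1.
have dz := @is_derive_cutoff R L^-1; have dz1 := @is_derive_cutoff1 R L^-1.
have zNL : cutoff L^-1 (- L) = 0.
  by rewrite /cutoff mulNr mulfV ?gt_eqF // sqrrN expr1n subrr expr0n.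
have z0 y : 0 <= cutoff L^-1 y := cutoff_ge0 L y.
have z_le1 y : - L <= y <= L -> cutoff L^-1 y <= 1 := @cutoff_le1 _ _ _ L0.
have z1_le y : - L <= y <= L -> `|cutoff1 L^-1 y| <= 4 * L^-1 :=
  @norm_cutoff1_le _ _ _ L0.
have z1_le_x y : - L <= y <= L -> `|cutoff1 L^-1 y| <= 4 * L^-1 * (`|y| / L) :=
  @norm_cutoff1_le_x _ _ _ L0.
have z_sqr y : - L <= y <= L -> exists a, [/\ 0 <= a, a ^+ 2 = cutoff L^-1 y &
    `|cutoff1 L^-1 y| <= 4 * L^-1 * a].
  move=> yL; exists (1 - (y * L^-1) ^+ 2).
  have := norm_cutoff1_le_sqrt L0 yL; set a := 1 - _ => za; split => //.
  by rewrite -(@pmulr_rge0 _ (4 * L^-1)) ?mulr_gt0 //; apply: le_trans za.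
move: (cutoff L^-1) (cutoff1 L^-1) (cutoff2 L^-1) dz dz1 zNL z0 z_le1 z1_le z1_le_x
  z_sqr => z z1 z2 dz dz1 zNL z0 z_le1 z1_le z1_le_x z_sqr.
have cz := derive_continuous dz; have cz1 := derive_continuous dz1.
have cid : cont2 (fun x _ : R => x) by apply: cont2_fst => ?; exact: cvg_id.
have chf : cont2 (fun x y => h (f x y)) by exact: cont2_post.
have ch1f : cont2 (fun x y => h1 (f x y)) by exact: cont2_post.
have ch2f : cont2 (fun x y => h2 (f x y)) by exact: cont2_post.
pose G y := int1 L (fun t => g t y).
have cG : continuous G by exact: continuous_int1.
have G0 y : 0 <= G y by exact: int1_ge0.
have bG x y : - L <= x <= L -> - L <= y <= L -> `|b x y| <= C * L + G y.
  exact: bC.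
have iG0 : 0 <= int1 L G by exact: int1_ge0.
have iGK : int1 L G <= K by exact: gK.
clearbody G.
set T := int2 L (fun x y => h (f x y) * (`|x| / L)).
set I := int2 L (fun x y => z x * z y * h2 (f x y) * f2 x y ^+ 2).
pose W x y := `|z1 x| * `|h1 (f x y) * f2 x y * z y + h (f x y) * z1 y|.
have cW : cont2 W by rewrite /W; cont2_tac.
pose S := int2 L W.
(* The energy appears here because the cut-off is a square: a single factor [a] comes
   from its derivative, and Young's inequality needs [a ^ 2]. *)
have SI : S <= L^-1 * (2 * C0 * K + 16 * K) + 2 * L^-1 * I.
  have cU : cont2 (fun x y => (2 * L^-1 * C0 + 16 * L^-1) * h (f x y) +
      2 * L^-1 * (z x * z y * h2 (f x y) * f2 x y ^+ 2)) by cont2_tac.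
  have WU x y : - L <= x <= L -> - L <= y <= L ->
      W x y <= (2 * L^-1 * C0 + 16 * L^-1) * h (f x y) +
      2 * L^-1 * (z x * z y * h2 (f x y) * f2 x y ^+ 2).
    move=> xL yL.
    have zy0 := z0 y; have zy1 := z_le1 y yL; have zx0 := z0 x.
    have [a [a0 aE zx1a]] := z_sqr x xL.
    have zx1 := z1_le x xL; have zy1' := z1_le y yL.
    have hs := h_ge0 (f x y).
    have step1 : `|z1 x| * `|h1 (f x y) * f2 x y * z y| <=
        2 * L^-1 * (C0 * h (f x y) + z x * z y * h2 (f x y) * f2 x y ^+ 2).
      apply: (@le_trans _ _ (4 * L^-1 * a * `|h1 (f x y) * (f2 x y * z y)|)).
        by rewrite mulrA ler_wpM2r.
      rewrite -mulrA.
      have -> : 2 * L^-1 * (C0 * h (f x y) + z x * z y * h2 (f x y) * f2 x y ^+ 2)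
         = 4 * L^-1 * ((C0 * h (f x y) + z x * z y * h2 (f x y) * f2 x y ^+ 2) / 2).
        by field; rewrite gt_eqF.
      rewrite ler_pM2l ?mulr_gt0 //.
      apply: le_trans (profile_young (f x y) (f2 x y * z y) a0) _.
      rewrite ler_pM2r ?invr_gt0 // lerD2l.
      rewrite aE.
      have -> : z x * h2 (f x y) * (f2 x y * z y) ^+ 2 =
          z x * z y * h2 (f x y) * f2 x y ^+ 2 * z y by ring.
      by rewrite ler_piMr // mulr_ge0 ?sqr_ge0 // mulr_ge0 // mulr_ge0.
    have step2 : `|z1 x| * `|h (f x y) * z1 y| <= 16 * L^-1 * h (f x y).
      rewrite [`|h _ * _|]normrM (ger0_norm hs).
      have : `|z1 x| * `|z1 y| <= 4 * L^-1 * (4 * 1).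
        by apply: ler_pM => //; apply: le_trans zy1' _; rewrite ler_pM2l.
      move=> /(ler_wpM2r hs).
      have -> : 4 * L^-1 * (4 * 1) * h (f x y) = 16 * L^-1 * h (f x y) by ring.
      by rewrite mulrAC -mulrA.
    have step3 : W x y <= `|z1 x| * `|h1 (f x y) * f2 x y * z y| +
        `|z1 x| * `|h (f x y) * z1 y|.
      by rewrite -mulrDr ler_wpM2l ?ler_normD.
    apply: le_trans step3 (le_trans (lerD step1 step2) _).
    by rewrite le_eqVlt; apply/orP; left; apply/eqP; ring.
  apply: le_trans (le_int2 cW cU WU) _.
  rewrite int2D ?int2Z //; try by cont2_tac.
  rewrite -/I lerD2r.
  have -> : L^-1 * (2 * C0 * K + 16 * K) = (2 * L^-1 * C0 + 16 * L^-1) * K.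
    by ring.
  apply: ler_wpM2l hfK; have := ltW l0.
  by move=> l0'; rewrite addr_ge0 // !mulr_ge0.
have S0 : 0 <= S by apply: int2_ge0 => x y _ _; rewrite mulr_ge0.
have cw : cont2 (fun x y => h (f x y) * (`|z1 x| * z y)) by cont2_tac.
pose H y := int1 L (fun x => h (f x y) * (`|z1 x| * z y)).
have cH : continuous H by exact: (continuous_int1 cw).
have HS y : - L <= y <= L -> H y <= S.
  move=> yL; rewrite /S -(int2_swap L cW).
  apply: le_int1.
  - exact: cont2_slice1 cw.
  - exact: (@continuous_int1 _ L (flip W) (cont2_flip cW)).
  - move=> x xL.
    have cd : cont2 (fun x y => h1 (f x y) * f2 x y * z y + h (f x y) * z1 y).
      by cont2_tac.
    have dhf := D2_comp dh df2; have dzy := D2_snd dz.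
    have := osc_le_int1 (D2M dhf dzy x) (cont2_slice2 cd) yL (_ : - L <= - L <= L).
    rewrite zNL mulr0 subr0 => /(_ _)/le_trans => Hosc.
    rewrite /W int1Z; last first.
      by apply: continuous_normr; exact: cont2_slice2 cd.
    rewrite mulrCA ler_wpM2l //.
    rewrite -[X in X <= _]ger0_norm; last by rewrite mulr_ge0.
    by apply: Hosc => //; lra.
have cB : cont2 (fun x y => 4 * C * (h (f x y) * (`|x| / L)) +
    G y * (h (f x y) * (`|z1 x| * z y))) by cont2_tac.
apply: (@le_trans _ _ (int2 L (fun x y => 4 * C * (h (f x y) * (`|x| / L)) +
    G y * (h (f x y) * (`|z1 x| * z y))))).
  apply: le_int2 => //; first by cont2_tac.
  move=> x y xL yL; have hs := h_ge0 (f x y).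
  have zy0 := z0 y; have zy1 := z_le1 y yL; have zx1 := z1_le_x x xL.
  set w := `|z1 x| * z y; have w0 : 0 <= w by rewrite mulr_ge0.
  have wx : w <= 4 * L^-1 * (`|x| / L).
    by apply: le_trans zx1; rewrite /w ler_piMr.
  apply: (@le_trans _ _ (h (f x y) * (C * L + G y) * w)).
    by rewrite ler_wpM2r // ler_wpM2l //; exact: bG.
  have -> : h (f x y) * (C * L + G y) * w =
     (h (f x y) * (C * L)) * w + G y * (h (f x y) * w) by ring.
  rewrite lerD2r.
  apply: le_trans (ler_wpM2l _ wx) _; first by rewrite !mulr_ge0 // ltW.
  rewrite le_eqVlt; apply/orP; left; apply/eqP; field.
  by rewrite gt_eqF.
rewrite int2D ?int2Z //; try by cont2_tac.
rewrite -/T lerD2l.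
apply: (@le_trans _ _ (int1 L (fun y => S * G y))).
  have -> : int2 L (fun x y => G y * (h (f x y) * (`|z1 x| * z y))) =
      int1 L (fun y => G y * H y).
    by apply: eq_int1 => y _; rewrite int1Z //; exact: cont2_slice1 cw.
  apply: le_int1.
  - by move=> y; apply: cvgM; [exact: cG|exact: cH].
  - by move=> y; apply: cvgM; [exact: cvg_cst|exact: cG].
  - by move=> y yL; rewrite mulrC ler_wpM2r //; exact: HS.
rewrite int1Z // mulrC.
exact: ler_pM.
Qed.

End Estimate.

(** * A Liouville theorem for drift-diffusion equations *)

Section Tail.
Variable R : realType.

Lemma int2_cst (L c : R) : 0 <= L -> int2 L (fun _ _ => c) = 4 * L ^+ 2 * c.
Proof.
move=> L0; rewrite /int2 (eq_int1 (g := fun=> 2 * L * c)).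
  by rewrite int1_cst //; ring.
by move=> x _; rewrite int1_cst.
Qed.

(** The integral converges, so most of it sits in a fixed square of side [2 r], where
    the weight [|x| / L] is at most [r / L]. *)
Lemma int2_tail (F : R -> R -> R) K : cont2 F -> (forall x y, 0 <= F x y) ->
  (forall L, 0 < L -> int2 L F <= K) ->
  forall e, 0 < e -> exists2 L0, 0 < L0 & forall L, L0 <= L ->
    int2 L (fun x y => F x y * (`|x| / L)) <= e.
Proof.
move=> cF F0 FK e e0.
pose A := [set int2 L F | L in [set L : R | 0 < L]].
have supA : has_sup A.
  split; first by exists (int2 1 F); exists 1 => //=.
  by exists K => _ [L /= L0 <-]; exact: FK.
have e2 : 0 < e / 2 by lra.
have [_ [r /= r0 <-] rsup] := sup_adherent e2 supA.
have K0 : 0 <= K by apply: le_trans (FK 1 ltr01); exact: int2_ge0.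
exists (r + 2 * r * K / e).
  by rewrite ltr_wpDr // divr_ge0 ?(ltW e0) // mulr_ge0 // mulr_ge0 // ltW.
move=> L Ll; have q0 : 0 <= 2 * r * K / e.
  by rewrite divr_ge0 ?(ltW e0) // mulr_ge0 // mulr_ge0 // ltW.
have rL : r <= L by apply: le_trans Ll; rewrite lerDl.
have L0 : 0 < L by exact: lt_le_trans r0 rL.
have l0 : 0 < L^-1 by rewrite invr_gt0.
have cx : cont2 (fun x _ : R => `|x| / L).
  apply: cont2M; last exact: cont2_cst.
  by apply: cont2_norm; apply: cont2_fst => ?; exact: cvg_id.
have cFx := cont2M cF cx.
have LK : int2 L F <= sup A.
  by apply: ub_le_sup; [exact: (proj2 supA)|exists L].
pose m := fun x _ : R => Num.max 0 (1 - `|x| / L).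
have cm : cont2 m.
  apply: (@cont2_fst _ (fun x => Num.max 0 (1 - `|x| / L))) => x.
  apply: (@continuous_max _ _ (fun=> 0) (fun x => 1 - `|x| / L)).
    exact: cvg_cst.
  apply: cvgB; first exact: cvg_cst.
  by apply: cvgM; [apply: cvg_norm; exact: cvg_id|exact: cvg_cst].
have m0 x y : 0 <= m x y by rewrite /m le_max lexx.
have inL x : - L <= x <= L -> `|x| / L <= 1.
  by move=> xL; rewrite ler_pdivrMr // mul1r ler_norml.
have split_L : int2 L (fun x y => F x y * (`|x| / L)) =
    int2 L F - int2 L (fun x y => F x y * m x y).
  apply/eqP; rewrite eq_sym subr_eq -(int2D L cFx (cont2M cF cm)).
  rewrite eq_sym; apply/eqP; apply: eq_int1 => y _; apply: eq_int1 => x xL.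
  by rewrite /m (max_idPr _) ?subr_ge0 ?inL //; ring.
have low : (1 - r / L) * int2 r F <= int2 L (fun x y => F x y * m x y).
  apply: (@le_trans _ _ (int2 r (fun x y => F x y * m x y))).
    rewrite -(int2Z r (1 - r / L) cF); apply: le_int2.
    - exact: (cont2M (@cont2_cst _ (1 - r / L)) cF).
    - exact: (cont2M cF cm).
    - move=> x y xr _; rewrite mulrC ler_wpM2l // /m le_max; apply/orP; right.
      by rewrite lerD2l lerN2 ler_pM2r // ler_norml.
  apply: int2_mono => //; first exact: (cont2M cF cm).
  by move=> x y; rewrite mulr_ge0.
rewrite split_L.
have IrK := FK r r0.
have : r / L * int2 r F <= e / 2.
  apply: (@le_trans _ _ (r / L * K)).
    by rewrite ler_wpM2l // divr_ge0 // ltW.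
  rewrite mulrAC ler_pdivrMr // mulrC.
  have : 2 * r * K / e <= L by apply: le_trans Ll; rewrite lerDr ltW.
  by rewrite ler_pdivrMr //; clear; lra.
move: low LK rsup; rewrite mulrBl mul1r.
move: (int2 _ (fun x y => _ * m _ _)) (int2 r F) (int2 L F) (sup A) (r / L * _).
by clear; move=> *; lra.
Qed.

End Tail.

(** The arithmetic of absorption: [I1] and [I2] are the two halves of the energy,
    [E1] and [E2] the two drift terms, [l] is [1 / L]. As [8 K l <= 1], the energy
    on the right is at most a half of the one on the left. *)
Lemma absorb_drift (R : realFieldType) (C0 C1 C2 K k l T1 T2 I1 I2 E1 E2 : R) :
  0 <= C1 -> 0 <= C2 -> 0 <= K -> 0 <= C0 -> 0 <= k -> k <= K ->
  0 < l -> l <= 1 -> 8 * (K * l) <= 1 -> 0 <= T1 -> 0 <= T2 ->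
  0 <= I1 -> 0 <= I2 ->
  I1 + I2 <= (8 * l ^+ 2 + 8 * l ^+ 2) * k + E1 + E2 ->
  E1 <= 4 * C1 * T1 + K * (l * (2 * C0 * K + 16 * K) + 2 * l * I2) ->
  E2 <= 4 * C2 * T2 + K * (l * (2 * C0 * K + 16 * K) + 2 * l * I1) ->
  I1 + I2 <= 8 * (C1 + C2) * (T1 + T2) +
    (32 * K + 4 * K * (2 * C0 * K + 16 * K)) * l.
Proof.
move=> C10 C20 K0 C00 k0 kK l0 l1 Kl T10 T20 I10 I20 low e1 e2.
have a1 : l ^+ 2 * k <= l * K.
  by apply: ler_pM => //; rewrite ?sqr_ge0 // expr2 ler_piMr // ltW.
have q1 := ler_wpM2r I10 Kl; have q2 := ler_wpM2r I20 Kl.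
have := mulr_ge0 C10 T20; have := mulr_ge0 C20 T10.
have := mulr_ge0 C10 T10; have := mulr_ge0 C20 T20.
move: low e1 e2 a1 q1 q2 I10 I20; clear => *; lra.
Qed.

Lemma cutoff_ge_quarter (R : realType) (r L s t : R) : 0 < r -> 2 * r <= L ->
  - r <= s <= r -> - r <= t <= r ->
  1 / 4 <= cutoff L^-1 s * cutoff L^-1 t.
Proof.
move=> r0 rL; have L0 : 0 < L by lra.
have half x : - r <= x <= r -> 1 / 2 <= cutoff L^-1 x.
  move=> xr; have xL : `|x * L^-1| <= 1 / 2.
    rewrite normrM normfV (gtr0_norm L0) ler_pdivrMr //.
    have : `|x| <= r by rewrite ler_norml.
    lra.
  have : (x * L^-1) ^+ 2 <= (1 / 2) ^+ 2.
    by rewrite -real_normK ?num_real // lerXn2r ?nnegrE //; lra.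
  by rewrite /cutoff; move: (_ ^+ 2) => q; clear; nra.
move=> /half s2 /half t2.
have q0 : 0 <= 1 / 2 :> R by lra.
apply: le_trans (ler_pM q0 q0 s2 t2); lra.
Qed.

Lemma absorb_tail (R : realFieldType) (A b d J T1 T2 : R) : 0 <= A ->
  T1 <= d -> T2 <= d -> b <= d -> J <= A * (T1 + T2) + b -> J <= d * (2 * A + 1).
Proof.
by move=> A0 H1 H2 bd JA; have := ler_wpM2l A0 (lerD H1 H2); lra.
Qed.

Lemma common_bound (R : realDomainType) (a b c d : R) :
  exists2 L, [/\ a <= L, b <= L & c <= L] & d <= L.
Proof.
exists (Num.max (Num.max a b) (Num.max c d)).
  by split; rewrite !le_max lexx ?orbT.
by rewrite !le_max lexx ?orbT.
Qed.

Section Liouville.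
Variables (R : realType) (h h1 h2 : R -> R) (C0 : R).
Hypothesis hp : convex_profile h h1 h2 C0.
Let dh := profile_d1 hp.
Let dh1 := profile_d2 hp.
Let ch2 := profile_c2 hp.
Let h_ge0 := profile_ge0 hp.
Let h2_ge0 := profile_h2_ge0 hp.
Let C0_ge0 := profile_C0_ge0 hp.
Let ch := continuous_profile hp.
Let ch1 := continuous_profile1 hp.

Variables (f f1 f2 f11 f22 b1 b2 b11 b12 b21 b22 : R -> R -> R) (K : R).
Hypothesis cf : cont2 f.
Hypotheses (df1 : D1 f f1) (df2 : D2 f f2).
Hypotheses (df11 : D1 f1 f11) (df22 : D2 f2 f22).
Hypotheses (cf1 : cont2 f1) (cf2 : cont2 f2).
Hypotheses (cf11 : cont2 f11) (cf22 : cont2 f22).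
Hypotheses (cb1 : cont2 b1) (cb2 : cont2 b2).
Hypotheses (db11 : D1 b1 b11) (db12 : D2 b1 b12).
Hypotheses (db21 : D1 b2 b21) (db22 : D2 b2 b22).
Hypotheses (cb11 : cont2 b11) (cb12 : cont2 b12).
Hypotheses (cb21 : cont2 b21) (cb22 : cont2 b22).
Hypothesis div0 : forall x y, b11 x y + b22 x y = 0.
Hypothesis eqn : forall x y, f11 x y + f22 x y = b1 x y * f1 x y + b2 x y * f2 x y.
Hypothesis hfK : forall L, 0 < L -> int2 L (fun x y => h (f x y)) <= K.
Hypothesis hb11K : forall L, 0 < L -> int2 L (fun x y => h (b11 x y)) <= K.
Hypothesis hb12K : forall L, 0 < L -> int2 L (fun x y => h (b12 x y)) <= K.
Hypothesis hb21K : forall L, 0 < L -> int2 L (fun x y => h (b21 x y)) <= K.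
Hypothesis hb22K : forall L, 0 < L -> int2 L (fun x y => h (b22 x y)) <= K.

Let K0 : 0 <= K.
Proof. by apply: le_trans (hfK ltr01); apply: int2_ge0 => *; exact: h_ge0. Qed.

Let chf : cont2 (fun x y => h (f x y)). Proof. exact: cont2_post. Qed.
Let ch2f : cont2 (fun x y => h2 (f x y)). Proof. exact: cont2_post. Qed.

Lemma energy_le_drift (L m : R) (z z1 z2 : R -> R) : 0 < L ->
  (forall x : R, is_derive x 1 z (z1 x)) ->
  (forall x : R, is_derive x 1 z1 (z2 x)) -> continuous z2 ->
  z L = 0 -> z (- L) = 0 -> z1 L = 0 -> z1 (- L) = 0 ->
  (forall x, 0 <= z x) -> (forall x, - L <= x <= L -> z x <= 1) ->
  (forall x, - L <= x <= L -> `|z2 x| <= m) ->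
  int2 L (fun x y => z x * z y * h2 (f x y) * (f1 x y ^+ 2 + f2 x y ^+ 2)) <=
  (m + m) * int2 L (fun x y => h (f x y)) +
   int2 L (fun x y => h (f x y) * `|b1 x y| * (`|z1 x| * z y)) +
   int2 L (fun x y => h (f x y) * `|b2 x y| * (`|z1 y| * z x)).
Proof.
move=> L0 dz dz1 cz2 zL zNL z1L z1NL z0 z_le1 z2_le.
have -> := energy_identity hp cf df1 df2 df11 df22 cf1 cf2 cf11 cf22 cb1 cb2
  db11 db22 cb11 cb22 div0 eqn L0 dz dz1 cz2 zL zNL z1L z1NL.
have cz := derive_continuous dz; have cz1 := derive_continuous dz1.
have cd1 : cont2 (fun x y => h (f x y) * `|b1 x y| * (`|z1 x| * z y)).
  by cont2_tac.
have cd2 : cont2 (fun x y => h (f x y) * `|b2 x y| * (`|z1 y| * z x)).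
  by cont2_tac.
have cm : cont2 (fun x y => (m + m) * h (f x y)).
  by exact: cont2M (@cont2_cst _ (m + m)) chf.
rewrite -(int2Z L (m + m) chf) -(int2D L cm cd1) -(int2D L (cont2D cm cd1) cd2).
have cl : cont2 (fun x y => h (f x y) * (z2 x * z y + z x * z2 y +
  (b1 x y * z1 x * z y + b2 x y * z x * z1 y))) by cont2_tac.
apply: (le_int2 cl (cont2D (cont2D cm cd1) cd2)) => x y xL yL.
have -> : (m + m) * h (f x y) + h (f x y) * `|b1 x y| * (`|z1 x| * z y) +
  h (f x y) * `|b2 x y| * (`|z1 y| * z x) = h (f x y) *
  (m + m + (`|b1 x y| * `|z1 x| * z y + `|b2 x y| * z x * `|z1 y|)) by ring.
apply: (ler_wpM2l (h_ge0 (f x y))).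
have pn (s t : R) : 0 <= t -> s * t <= `|s| * t.
  by move=> t0; apply: (ler_wpM2r t0); exact: ler_norm.
have zz (s t : R) : `|s| <= m -> 0 <= t -> t <= 1 -> s * t <= m.
  move=> sl t0 t1; apply: le_trans (pn _ _ t0) _.
  by apply: le_trans sl; rewrite ler_piMr.
apply: lerD; apply: lerD.
- exact: zz (z2_le x xL) (z0 y) (z_le1 y yL).
- by rewrite mulrC; exact: zz (z2_le y yL) (z0 x) (z_le1 x xL).
- by rewrite -normrM; exact: pn.
- by rewrite mulrAC [`|_| * _ * _]mulrAC -normrM; exact: pn.
Qed.

(** The second drift term is the first one for the flipped functions, which is why
    the mirror image of the tail integral appears. *)
Lemma energy_estimate : exists A B, [/\ 0 <= A, 0 <= B &
  forall L, 1 + 8 * K <= L ->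
  int2 L (fun x y => cutoff L^-1 x * cutoff L^-1 y * h2 (f x y) *
     (f1 x y ^+ 2 + f2 x y ^+ 2)) <=
  A * (int2 L (fun x y => h (f x y) * (`|x| / L)) +
       int2 L (fun x y => h (f y x) * (`|x| / L))) + B / L].
Proof.
have [C1 C1_ge0 g1] := profile_growth hp cb1 db11 db12 cb11 cb12 hb12K.
have hb21K' L : 0 < L -> int2 L (fun x y => h (flip b21 x y)) <= K.
  move=> L0; rewrite (@int2_swap _ L (fun x y => h (b21 x y))); first exact: hb21K.
  exact: cont2_post.
have [C2 C2_ge0 g2] := profile_growth hp (cont2_flip cb2) (D2_flip db22)
  (D1_flip db21) (cont2_flip cb22) (cont2_flip cb21) hb21K'.
exists (8 * (C1 + C2)), (32 * K + 4 * K * (2 * C0 * K + 16 * K)).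
split.
- by rewrite mulr_ge0 // addr_ge0.
- rewrite addr_ge0 // mulr_ge0 // ?mulr_ge0 //.
  by rewrite addr_ge0 // !mulr_ge0.
move=> L LK; have L1 : 1 <= L by apply: le_trans LK; rewrite lerDl mulr_ge0.
have L0 : 0 < L by exact: lt_le_trans L1.
have l0 : 0 < L^-1 by rewrite invr_gt0.
have l1 : L^-1 <= 1 by rewrite invf_le1.
have Kl : 8 * (K * L^-1) <= 1.
  by rewrite mulrA ler_pdivrMr // mul1r; apply: le_trans LK; rewrite lerDr.
have z0 y : 0 <= cutoff L^-1 y := cutoff_ge0 L y.
have lL : L * L^-1 = 1 by rewrite mulfV ?gt_eqF.
have low := @energy_le_drift L (8 * L^-1 ^+ 2) (cutoff L^-1) (cutoff1 L^-1)
  (cutoff2 L^-1) L0 (@is_derive_cutoff R L^-1) (@is_derive_cutoff1 R L^-1)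
  (@continuous_cutoff2 R L^-1).
have {}low := low
  (ltac:(by rewrite /cutoff lL expr1n subrr expr0n))
  (ltac:(by rewrite /cutoff mulNr lL sqrrN expr1n subrr expr0n))
  (ltac:(by rewrite /cutoff1 lL expr1n subrr mulr0))
  (ltac:(by rewrite /cutoff1 [- L * _]mulNr lL sqrrN expr1n subrr mulr0))
  z0 (@cutoff_le1 _ _ ^~ L0) (@norm_cutoff2_le _ _ ^~ L0).
have cz : continuous (cutoff L^-1) := derive_continuous (@is_derive_cutoff R L^-1).
have cz1 : continuous (cutoff1 L^-1) := derive_continuous (@is_derive_cutoff1 R L^-1).
have e1 := @drift_estimate _ _ _ _ _ hp f f2 b1 (fun x y => h (b11 x y)) C1 K L
  cf df2 cf2 cb1 (cont2_post ch cb11) (fun x y => h_ge0 _) L1 C1_ge0 K0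
  (fun x y => g1 L x y L1) (hfK L0) (hb11K L0).
have e2 := @drift_estimate _ _ _ _ _ hp (flip f) (flip f1) (flip b2)
  (fun x y => h (flip b22 x y)) C2 K L
  (cont2_flip cf) (D1_flip df1) (cont2_flip cf1) (cont2_flip cb2)
  (cont2_flip (cont2_post ch cb22)) (fun x y => h_ge0 _) L1 C2_ge0 K0
  (fun x y => g2 L x y L1).
have {}e2 := e2 (eq_ind_r (fun t => t <= K) (hfK L0) (int2_swap L chf))
  (eq_ind_r (fun t => t <= K) (hb22K L0) (int2_swap L (cont2_post ch cb22))).
move: (cutoff L^-1) (cutoff1 L^-1) cz cz1 z0 low e1 e2 => z z1 cz cz1 z0.
have cI1 : cont2 (fun x y => z x * z y * h2 (f x y) * f1 x y ^+ 2) by cont2_tac.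
have cI2 : cont2 (fun x y => z x * z y * h2 (f x y) * f2 x y ^+ 2) by cont2_tac.
have cd2 : cont2 (fun x y => h (f x y) * `|b2 x y| * (`|z1 y| * z x)).
  by cont2_tac.
have w0 x y : 0 <= z x * z y * h2 (f x y).
  by apply: mulr_ge0; [exact: mulr_ge0|exact: h2_ge0].
have IE : int2 L (fun x y => z x * z y * h2 (f x y) *
    (f1 x y ^+ 2 + f2 x y ^+ 2)) =
    int2 L (fun x y => z x * z y * h2 (f x y) * f1 x y ^+ 2) +
    int2 L (fun x y => z x * z y * h2 (f x y) * f2 x y ^+ 2).
  rewrite -(int2D L cI1 cI2); congr int2; apply/funext => x; apply/funext => y.
  by rewrite mulrDr.
have e2E : int2 L (fun x y => z x * z y * h2 (flip f x y) * flip f1 x y ^+ 2) =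
   int2 L (fun x y => z x * z y * h2 (f x y) * f1 x y ^+ 2).
  rewrite -(int2_swap L cI1); congr int2; apply/funext => x; apply/funext => y.
  by rewrite /flip (mulrC (z x)).
rewrite IE e2E (int2_swap L cd2) /flip.
have : 0 <= int2 L (fun x y => z x * z y * h2 (f x y) * f1 x y ^+ 2).
  by apply: int2_ge0 => x y _ _; apply: mulr_ge0 (w0 x y) (sqr_ge0 _).
have : 0 <= int2 L (fun x y => z x * z y * h2 (f x y) * f2 x y ^+ 2).
  by apply: int2_ge0 => x y _ _; apply: mulr_ge0 (w0 x y) (sqr_ge0 _).
have xl0 (x : R) : 0 <= `|x| / L := divr_ge0 (normr_ge0 x) (ltW L0).
have : 0 <= int2 L (fun x y => h (f x y) * (`|x| / L)).
  by apply: int2_ge0 => x y _ _; apply: mulr_ge0 (h_ge0 _) (xl0 _).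
have : 0 <= int2 L (fun x y => h (f y x) * (`|x| / L)).
  by apply: int2_ge0 => x y _ _; apply: mulr_ge0 (h_ge0 _) (xl0 _).
have : 0 <= int2 L (fun x y => h (f x y)) by apply: int2_ge0 => x y _ _.
have := hfK L0.
move: (int2 L (fun x y => z x * z y * h2 (f x y) * f1 x y ^+ 2))
  (int2 L (fun x y => z x * z y * h2 (f x y) * f2 x y ^+ 2))
  (int2 L (fun x y => h (f x y))) (int2 L (fun x y => h (f x y) * (`|x| / L)))
  (int2 L (fun x y => h (f y x) * (`|x| / L)))
  (int2 L (fun x y => h (f x y) * `|b1 x y| * (`|z1 x| * z y)))
  (int2 L (fun x y => h (f x y) * `|b2 x y| * (`|z1 y| * z x)))
  => I1 I2 k T1 T2 E1 E2 kK k0 T20 T10 I20 I10.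
move: (L^-1) l0 l1 Kl => l l0 l1 Kl.
move: C1_ge0 C2_ge0 K0 C0_ge0 k0 kK l0 l1 Kl T10 T20 I10 I20.
exact: absorb_drift.
Qed.

(** Both tails and [B / L] tend to [0], so the energy density vanishes identically;
    by [profile_sqr] so does the gradient of [h (f)]. A constant that is integrable
    over the plane is [0]. *)
Lemma liouville x y : f x y = 0.
Proof.
have [A [B [A0 B0 est]]] := energy_estimate.
pose phi x y := h2 (f x y) * (f1 x y ^+ 2 + f2 x y ^+ 2).
have cphi : cont2 phi by rewrite /phi; cont2_tac.
have phi0 s t : 0 <= phi s t by rewrite mulr_ge0 // addr_ge0 ?sqr_ge0.
have cfl : cont2 (fun x y => h (f y x)) := cont2_flip chf.
have hflK L : 0 < L -> int2 L (fun x y => h (f y x)) <= K.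
  by move=> L0; rewrite (int2_swap L chf); exact: hfK.
have small r e : 0 < r -> 0 < e -> int2 r phi <= e.
  move=> r0 e0.
  have A4 : 0 < 4 * (2 * A + 1) by rewrite mulr_gt0 // ltr_wpDl // mulr_ge0.
  have [d d0 ->] : exists2 d, 0 < d & e = d * (4 * (2 * A + 1)).
    by exists (e / (4 * (2 * A + 1))); rewrite ?divr_gt0 // divfK // gt_eqF.
  have [L1 L10 H1] := int2_tail chf (fun x y => h_ge0 _) hfK d0.
  have [L2 L20 H2] := int2_tail cfl (fun x y => h_ge0 _) hflK d0.
  have [L' [LL1 LL2 rL'] KL'] := common_bound L1 L2 (2 * r) (1 + 8 * K).
  have [L [LL' BdL _] _] := common_bound L' (B / d) 0 0.
  have rL := le_trans rL' LL'; have L0 := lt_le_trans L10 (le_trans LL1 LL').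
  have := est L (le_trans KL' LL').
  have BL : B / L <= d by rewrite ler_pdivrMr // mulrC -ler_pdivrMr.
  move=> /(absorb_tail A0 (H1 _ (le_trans LL1 LL')) (H2 _ (le_trans LL2 LL')) BL).
  have z0 s : 0 <= cutoff L^-1 s := cutoff_ge0 L s.
  have cz : continuous (cutoff L^-1) := derive_continuous (@is_derive_cutoff R L^-1).
  have quarter s t := @cutoff_ge_quarter R r L s t r0 rL.
  move: (cutoff L^-1) z0 cz quarter => z z0 cz quarter fin.
  have cE : cont2 (fun x y => z x * z y * h2 (f x y) * (f1 x y ^+ 2 + f2 x y ^+ 2)).
    by cont2_tac.
  have rL1 : r <= L by apply: le_trans rL; rewrite ler_peMl ?ler1n // ltW.
  suff : 1 / 4 * int2 r phi <= d * (2 * A + 1).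
    by rewrite mulrCA mul1r mulrC ler_pdivrMr // mulrC.
  apply: le_trans fin; rewrite -(int2Z r (1 / 4) cphi).
  apply: (@le_trans _ _ (int2 r (fun x y => z x * z y *
    h2 (f x y) * (f1 x y ^+ 2 + f2 x y ^+ 2)))).
    apply: (le_int2 (cont2M (@cont2_cst _ (1 / 4)) cphi) cE) => s t sr tr.
    rewrite -[X in _ <= X]mulrA.
    by apply: (ler_wpM2r (phi0 s t)); exact: quarter.
  apply: (int2_mono cE) => // s t; rewrite -mulrA.
  by apply: mulr_ge0 (phi0 s t); exact: mulr_ge0.
have phiE s t : phi s t = 0.
  pose r := `|s| + `|t| + 1.
  have r0 : 0 < r by rewrite ltr_wpDl // addr_ge0.
  apply: (int2_eq0 (L := r) cphi) => //.
  - rewrite leNgt; apply/negP => p.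
    have := small r _ r0 (divr_gt0 p (ltr0Sn _ 1)).
    by rewrite leNgt ltr_pdivrMr // mulr2n mulrDr mulr1 ltrDl p.
  - by rewrite -ltr_norml /r; have := normr_ge0 t; lra.
  - by rewrite -ltr_norml /r; have := normr_ge0 s; lra.
(* Dominating [d ^ 2] by the squared gradient covers both partial derivatives. *)
have grad0 s t d : d ^+ 2 <= f1 s t ^+ 2 + f2 s t ^+ 2 -> h1 (f s t) * d = 0.
  move=> dd; apply/eqP; rewrite -sqrf_eq0 eq_le sqr_ge0 andbT exprMn.
  apply: (@le_trans _ _ (C0 * h (f s t) * h2 (f s t) * (f1 s t ^+ 2 + f2 s t ^+ 2))).
    by apply: ler_pM; rewrite ?sqr_ge0 //; exact: profile_sqr hp _.
  by rewrite -mulrA -/(phi s t) phiE mulr0.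
have hcst s t : h (f s t) = h (f 0 0).
  apply: (@D12_cst _ (fun s t => h (f s t))).
  - apply: D1_ext (D1_comp dh df1) _ => {}s {}t.
    by apply: grad0; rewrite lerDl sqr_ge0.
  - apply: D2_ext (D2_comp dh df2) _ => {}s {}t.
    by apply: grad0; rewrite lerDr sqr_ge0.
(* a positive constant [c] has integral [4 M ^ 2 c > K] for [M = K / c + 1] *)
apply: (profile_eq0 hp); rewrite hcst; apply/eqP; rewrite eq_le h_ge0 andbT.
rewrite leNgt; apply/negP; set c := h (f 0 0) => c0.
have K0' := K0.
have L0 : 0 < K / c + 1 by rewrite ltr_wpDl // divr_ge0 // ltW.
have := hfK L0; under [X in int2 _ X]eq_fun do under eq_fun do rewrite hcst.
rewrite -/c int2_cst ?(ltW L0) //.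
have : (K / c + 1) * c = K + c by rewrite mulrDl mul1r divfK // gt_eqF.
have : 1 <= K / c + 1 by rewrite lerDr divr_ge0 // ltW.
set M := K / c + 1 => M1 Mc.
have : M * c <= 4 * M ^+ 2 * c.
  by rewrite ler_pM2r // expr2 mulrA ler_peMl //; lra.
lra.
Qed.

End Liouville.

(** * A convex profile for each exponent *)

Section Profile.
Variable R : realType.

(** The tangent of a concave function at [p] lies above its value at [1]. *)
Lemma powR_tangent (p a : R) : 1 <= p -> 0 < a -> a <= 1 ->
  a * (p - 1) * p `^ (a - 1) <= p `^ a - 1.
Proof.
move=> p1 a0 a1.
have dpow (x : R) : 0 < x -> is_derive x 1 (@powR R ^~ a) (a * x `^ (a - 1)).
  by move=> x0; exact: is_derive1_powR.
have [|c|c] := @MVT_segment _ (@powR R ^~ a) (fun x => a * x `^ (a - 1)) 1 p p1.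
- by move=> x; rewrite in_itv /= => /andP[x1 _]; apply: dpow; apply: lt_trans x1.
- apply: derivable_within_continuous => x; rewrite in_itv /= => /andP[x1 _].
  have [] // := dpow x (lt_le_trans ltr01 x1).
rewrite in_itv /= powR1 => /andP[c1 cp] ->.
rewrite mulrAC ler_wpM2r ?subr_ge0 // ler_wpM2l ?(ltW a0) //.
rewrite -(opprB 1 a) !powRN lef_pV2 ?posrE ?powR_gt0 //.
- by rewrite ge0_ler_powR ?subr_ge0 // nnegrE; apply: le_trans ler01 _.
- exact: lt_le_trans p1.
- exact: lt_le_trans c1.
Qed.

(** Divide by [(1 + z) ^ a]: a number of [0, 1] is at most its own power of exponent
    [a], and the two quotients add up to [1]. *)
Lemma powR_subadd1 (z a : R) : 0 <= z -> a <= 1 -> (1 + z) `^ a <= 1 + z `^ a.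
Proof.
move=> z0 a1; have p0 : 0 < 1 + z by rewrite ltr_pwDl.
have [->|zn0] := eqVneq z 0.
  by rewrite addr0 powR1 lerDl powR_ge0.
have zgt : 0 < z by rewrite lt_neqAle eq_sym zn0.
have pa0 : 0 < (1 + z) `^ a by exact: powR_gt0.
have le w : 0 < w -> w <= 1 + z -> w / (1 + z) * (1 + z) `^ a <= w `^ a.
  move=> w0 wz; have w1 : 0 < w / (1 + z) <= 1.
    by rewrite divr_gt0 // ler_pdivrMr // mul1r.
  rewrite -[X in _ <= X `^ a](@divfK _ (1 + z)) ?gt_eqF //.
  rewrite powRM ?(ltW p0) //; last by case/andP: w1 => /ltW.
  by rewrite ler_pM2r // ger1_powR.
have := lerD (le 1 ltr01 _) (le z zgt _); rewrite powR1.
rewrite -mulrDl -mulrDl divff ?gt_eqF // mul1r; apply.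
  by rewrite lerDl.
by rewrite lerDr.
Qed.

Variable q : R.
Hypothesis q1 : 1 < q.

(* [N] is even, so that [1 + s ^ N] is positive, and at least [q] *)
Let k := Num.truncn q.
Let N : nat := k.*2.+2.
Let Nq : q <= N%:R.
Proof.
rewrite /N; apply: (@le_trans _ _ k.+1%:R).
  by rewrite ltW // -truncn_lt_nat // (le_trans _ (ltW q1)).
by rewrite ler_nat ltnS -addnn leqW // leq_addr.
Qed.
Let a := q / N%:R.
Let N0 : 0 < N%:R :> R. Proof. by rewrite ltr0n. Qed.
Let q0 : 0 < q. Proof. exact: lt_trans q1. Qed.
Let a0 : 0 < a. Proof. by rewrite divr_gt0. Qed.
Let a1 : a <= 1. Proof. by rewrite ler_pdivrMr // mul1r. Qed.
Let aN : a * N%:R = q. Proof. by rewrite divfK ?gt_eqF. Qed.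

Let P (s : R) := 1 + s ^+ N.
Let prof (s : R) := P s `^ a - 1.
Let prof1 (s : R) := q * s ^+ N.-1 * P s `^ (a - 1).
Let prof2 (s : R) := q * s ^+ k.*2 * P s `^ (a - 1 - 1) *
  (N%:R - 1 + (q - 1) * s ^+ N).

Let sN_ge0 (s : R) : 0 <= s ^+ N.
Proof. by rewrite exprn_even_ge0 //= odd_double. Qed.
Let sk_ge0 (s : R) : 0 <= s ^+ k.*2.
Proof. by rewrite exprn_even_ge0 //= odd_double. Qed.
Let P_ge1 s : 1 <= P s. Proof. by rewrite lerDl. Qed.
Let P_gt0 s : 0 < P s. Proof. exact: lt_le_trans (P_ge1 s). Qed.

Let dX n (s : R) : is_derive s 1 (fun t : R => t ^+ n.+1) (n.+1%:R * s ^+ n).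
Proof.
have -> : (fun t : R => t ^+ n.+1) = (id : R -> R) ^+ n.+1.
  by apply/funext => t; rewrite exprfctE.
apply: is_derive_eq (is_deriveX n.+1 (is_derive_id s 1)) _.
by rewrite /GRing.scale /= mulr1 ?mulr_natl.
Qed.

Let dP (s : R) : is_derive s 1 P (N%:R * s ^+ N.-1).
Proof.
have dc : is_derive s 1 (fun _ : R => 1 : R) 0 by exact: is_derive_cst.
have dD := is_deriveD dc (dX k.*2.+1 s).
by apply: is_derive_eq dD _; rewrite add0r.
Qed.

Let dpowP b (s : R) : is_derive s 1 (fun t => P t `^ b)
  (b * N%:R * s ^+ N.-1 * P s `^ (b - 1)).
Proof.
apply: is_derive_eq (is_derive1_comp (is_derive1_powR b (P_gt0 s)) (dP s)) _.
by ring.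
Qed.

Let powP b s : P s `^ b = P s * P s `^ (b - 1).
Proof.
rewrite -[X in X * _](powRr1 (ltW (P_gt0 s))) -powRD; last first.
  by rewrite (gt_eqF (P_gt0 s)) implybT.
by rewrite addrC subrK.
Qed.

Let dprof (s : R) : is_derive s 1 prof (prof1 s).
Proof.
have dc : is_derive s 1 (fun _ : R => 1 : R) 0 by exact: is_derive_cst.
by apply: is_derive_eq (is_deriveB (dpowP a s) dc) _; rewrite subr0 aN.
Qed.

Let dprof1 (s : R) : is_derive s 1 prof1 (prof2 s).
Proof.
apply: is_derive_eq (is_deriveM (is_deriveZ q (dX k.*2 s)) (dpowP (a - 1) s)) _.
rewrite /GRing.scale /= /prof2 (powP (a - 1)).
have XE : s ^+ k.*2.+1 = s * s ^+ k.*2 by rewrite exprS.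
have ZE : s ^+ N = s * (s * s ^+ k.*2) by rewrite /N !exprS.
have NE : k.*2.+1%:R = N%:R - 1 :> R by rewrite /N [in RHS]mulrS addrC addrK.
rewrite XE ZE NE; set Q := P s `^ (a - 1 - 1).
rewrite (_ : P s = 1 + s * (s * s ^+ k.*2)); last by rewrite -ZE.
move: Q (s ^+ k.*2) => Q X.
have aN' := aN; move: (N%:R) aN' => n <-; rewrite /GRing.scale /=; ring.
Qed.

(** The function [(1 + s ^ N) ^ (q / N) - 1] is smooth: as [N] is even, its base is positive. It behaves
    like [|s| ^ q] at infinity, where [1 < q] makes it superlinear, and like
    [s ^ N] at [0], which [|s| ^ q] dominates because [q <= N]. *)
Lemma exists_profile : exists h h1 h2 C0, convex_profile h h1 h2 C0 /\
  forall s : R, h s <= `|s| `^ q.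
Proof.
have powP1 s b : 0 < P s `^ b by exact: powR_gt0.
have NE (s : R) : `|s| ^+ N = s ^+ N.
  by rewrite -normrX (ger0_norm (sN_ge0 s)).
have zq (s : R) : (s ^+ N) `^ a = `|s| `^ q.
  by rewrite -NE -powR_mulrn // -powRrM mulrC aN.
have P_ge s b : 0 <= b -> 1 <= P s `^ b.
  by move=> b0; rewrite -(powRr0 (P s)) ler_powR.
exists prof, prof1, prof2, (N%:R / (q - 1)); split; last first.
  by move=> s; rewrite lerBlDl -zq powR_subadd1.
have h2_ge0 s : (q - 1) * P s <= N%:R - 1 + (q - 1) * s ^+ N.
  by rewrite /P mulrDr mulr1 lerD2r lerD2r.
split.
- exact: dprof.
- exact: dprof1.
- move=> s; rewrite /prof2.
  have cX n : continuous (fun t : R => t ^+ n) by exact: exprn_continuous.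
  have cP b : continuous (fun t : R => P t `^ b).
    exact: (derive_continuous (dpowP b)).
  apply: (@continuousM R R (fun s => q * s ^+ k.*2 * P s `^ (a - 1 - 1))).
    apply: (@continuousM R R (fun s => q * s ^+ k.*2)); last exact: cP.
    by apply: (@continuousM R R (cst q)); [exact: cvg_cst|exact: cX].
  apply: continuousD; first exact: cvg_cst.
  by apply: (@continuousM R R (cst (q - 1))); [exact: cvg_cst|exact: cX].
- by move=> s; rewrite subr_ge0 P_ge // ltW.
- move=> s; rewrite /prof2 mulr_ge0 //.
    by rewrite mulr_ge0 ?(ltW (powP1 _ _)) // mulr_ge0 // ltW.
  by apply: le_trans (h2_ge0 s); rewrite mulr_ge0 ?subr_ge0 // ltW.
- by rewrite divr_ge0 ?subr_ge0 // ltW.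
- move=> s.
  have q10 : 0 < q - 1 by rewrite subr_gt0.
  have t1 : a * s ^+ N * P s `^ (a - 1) <= prof s.
    have := powR_tangent (P_ge1 s) a0 a1.
    by rewrite (_ : P s - 1 = s ^+ N) // /P addrC addKr.
  have t2 : q * s ^+ k.*2 * P s `^ (a - 1 - 1) * ((q - 1) * P s) <= prof2 s.
    rewrite /prof2 ler_wpM2l // mulr_ge0 ?(ltW (powP1 _ _)) // mulr_ge0 //.
    exact: ltW.
  have t10 : 0 <= a * s ^+ N * P s `^ (a - 1).
    by rewrite mulr_ge0 ?(ltW (powP1 _ _)) // mulr_ge0 // ltW.
  have t20 : 0 <= q * s ^+ k.*2 * P s `^ (a - 1 - 1) * ((q - 1) * P s).
    rewrite mulr_ge0 //; last by rewrite mulr_ge0 // ltW.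
    by rewrite mulr_ge0 ?(ltW (powP1 _ _)) // mulr_ge0 // ltW.
  have C00 : 0 <= N%:R / (q - 1) by rewrite divr_ge0 // ltW.
  rewrite -mulrA; apply: le_trans (ler_wpM2l C00 (ler_pM t10 t20 t1 t2)).
  rewrite le_eqVlt; apply/orP; left; apply/eqP.
  have XE : s ^+ N.-1 = s * s ^+ k.*2 by rewrite exprS.
  have ZE : s ^+ N = s * (s * s ^+ k.*2) by rewrite /N !exprS.
  rewrite /prof1 (powP (a - 1)) XE ZE.
  move: (P s) (P s `^ _) (s ^+ k.*2) => p Q X.
  have aN' := aN; move: (N%:R) N0 aN' => n n0 aN'.
  transitivity (a * n * q * (s * X * (p * Q)) ^+ 2); first by rewrite aN'; ring.
  by field; rewrite gt_eqF.
- move=> s; rewrite addrC subrK.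
  have [s1|s1] := leP `|s| 1; first by apply: le_trans s1 _; rewrite P_ge // ltW.
  apply: (@le_trans _ _ (`|s| `^ q)); first by rewrite le1r_powR // ltW.
  by rewrite -zq ge0_ler_powR ?nnegrE ?(ltW a0) ?(ltW (P_gt0 s)) // /P lerDr.
- move=> s; rewrite /prof => /eqP; rewrite subr_eq0 powR_eq1.
  rewrite ltNge (ltW (P_gt0 s)) (gt_eqF a0) !orbF /P -subr_eq0 addrC addKr.
  by rewrite expf_eq0 /= => /eqP.
Qed.


End Profile.

(** * Smooth functions on the plane *)

Section Schwarz.
Variable R : realType.
Implicit Types f : R -> R -> R.

(** The mean value theorem in each variable. *)
Lemma second_difference f f1 f12 (x y t : R) : 0 < t -> D1 f f1 -> D2 f1 f12 ->
  exists s r, [/\ x <= s <= x + t, y <= r <= y + t &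
    f (x + t) (y + t) - f (x + t) y - (f x (y + t) - f x y) = f12 s r * t * t].
Proof.
move=> t0 df1 df12.
have xt : x < x + t by rewrite ltrDl.
have yt : y < y + t by rewrite ltrDl.
pose F s := f s (y + t) - f s y.
have dF (s : R) : is_derive s 1 F (f1 s (y + t) - f1 s y).
  exact: is_deriveB (df1 s (y + t)) (df1 s y).
have [s] := MVT xt (fun s _ => dF s)
  (continuous_subspaceT (derive_continuous dF)).
rewrite in_itv /= => /andP[xs sx] FE.
have [r] := MVT yt (fun r _ => df12 s r)
  (continuous_subspaceT (derive_continuous (df12 s))).
rewrite in_itv /= => /andP[yr ry] fE.
exists s, r; rewrite !ltW //; split => //.
by move: FE; rewrite /F fE !(addrC _ t) !addrK => <-; ring.
Qed.

(** The second difference over a small square is symmetric under exchange of the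
    variables, so each mixed derivative takes near [(x, y)] a value that the other
    one takes there too; continuity concludes. *)
Lemma mixed_partials f f1 f2 f12 f21 : D1 f f1 -> D2 f f2 -> D2 f1 f12 ->
  D1 f2 f21 -> cont2 f12 -> cont2 f21 -> forall x y, f12 x y = f21 x y.
Proof.
move=> df1 df2 df12 df21 c12 c21 x y; apply/eqP; rewrite -subr_eq0 -normr_le0.
apply/ler_addgt0Pl => e e0; rewrite addr0.
have e2 : 0 < e / 2 by rewrite divr_gt0.
have /cvgrPdist_lt /(_ _ e2) /nbhs_ballP [d1 /= d10 H1] := c12 (x, y).
have /cvgrPdist_lt /(_ _ e2) /nbhs_ballP [d2 /= d20 H2] := c21 (x, y).
have [t t0 [td1 td2]] : exists2 t, 0 < t & t < d1 /\ t < d2.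
  exists (Num.min d1 d2 / 2); first by rewrite divr_gt0 // lt_min d10.
  have m0 : 0 < Num.min d1 d2 by rewrite lt_min d10.
  have tm : Num.min d1 d2 / 2 < Num.min d1 d2 by lra.
  by split; apply: lt_le_trans tm _; rewrite ge_min lexx ?orbT.
have [s [r [sx ry E1]]] := second_difference x y t0 df1 df12.
have [r' [s' [ry' sx' E2]]] := second_difference y x t0 (D2_flip df2) (D1_flip df21).
have E : f12 s r = f21 s' r'.
  have tt0 : t * t != 0 by rewrite mulf_neq0 ?gt_eqF.
  by apply: (mulIf tt0); rewrite !mulrA -E1 -[RHS]E2 /flip; ring.
have B d s0 r0 : t < d -> x <= s0 <= x + t -> y <= r0 <= y + t ->
    ball (x, y) d (s0, r0).
  by move=> td s0x r0y; split; rewrite /ball /= ltr_norml; lra.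
have /= a1 := H1 _ (B d1 s r td1 sx ry).
have /= a2 := H2 _ (B d2 s' r' td2 sx' ry').
have -> : f12 x y - f21 x y = (f12 x y - f12 s r) - (f21 x y - f21 s' r').
  by rewrite E; ring.
apply: le_trans (ler_normB _ _) _; lra.
Qed.

End Schwarz.

Section SmoothScalar.
Variable R : realType.
Local Notation A f := ('D_(e1 R) f).
Local Notation B f := ('D_(e2 R) f).

Lemma smooth_partials (V : normedModType R) (f : R * R -> V) : smooth f ->
  [/\ continuous f, forall x, derivable f x (e1 R),
      forall x, derivable f x (e2 R), smooth (A f) & smooth (B f)].
Proof.
move=> sf; have [cf [d1 d2 _ _]] := sf 1%N.
by split => // k; have [_ []] := sf k.+1.
Qed.

(** Used for the two coordinate projections, to pass from the vector field to its
    components. *)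
Lemma derive_post (V W : normedModType R) (phi : V -> W) (f : R * R -> V) x v :
  (forall a b, phi (a - b) = phi a - phi b) ->
  (forall (c : R) a, phi (c *: a) = c *: phi a) -> continuous phi ->
  derivable f x v ->
  derivable (phi \o f) x v /\ 'D_v (phi \o f) x = phi ('D_v f x).
Proof.
move=> phiB phiZ cphi df.
have H : h^-1 *: (((phi \o f) \o shift x) (h *: v) - (phi \o f) x) @[h --> 0^']
    --> phi ('D_v f x).
  under eq_fun do rewrite /= -phiB -phiZ.
  exact: (cvg_comp _ _ df (cphi _)).
split; first by apply/cvg_ex; exists (phi ('D_v f x)).
exact: cvg_lim H.
Qed.

Lemma Ck_post (V W : normedModType R) (phi : V -> W) k (f : R * R -> V) :
  (forall a b, phi (a - b) = phi a - phi b) ->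
  (forall (c : R) a, phi (c *: a) = c *: phi a) -> continuous phi ->
  Ck k f -> Ck k (phi \o f).
Proof.
move=> phiB phiZ cphi; elim: k f => [|k IH] f /=.
  by case=> cf _; split => // x; apply: continuous_comp; [exact: cf|exact: cphi].
case=> cf [d1 d2 C1 C2]; split.
  by move=> x; apply: continuous_comp; [exact: cf|exact: cphi].
have P1 x := derive_post phiB phiZ cphi (d1 x).
have P2 x := derive_post phiB phiZ cphi (d2 x).
split=> [x|x||]; [exact: (P1 x).1|exact: (P2 x).1|..].
- by rewrite (_ : A _ = phi \o A f); [exact: IH|apply/funext => x; exact: (P1 x).2].
- by rewrite (_ : B _ = phi \o B f); [exact: IH|apply/funext => x; exact: (P2 x).2].
Qed.

Implicit Types f g : R * R -> R.
Definition cur f : R -> R -> R := fun x y => f (x, y).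

Lemma cur_cont2 f : smooth f -> cont2 (cur f).
Proof.
move=> /smooth_partials[cf _ _ _ _].
by rewrite /cont2 /cur; under eq_fun do rewrite -surjective_pairing.
Qed.

Lemma cur_D1 f : smooth f -> D1 (cur f) (cur (A f)).
Proof.
move=> /smooth_partials[_ d1 _ _ _] x y.
have H : h^-1 *: ((cur f ^~ y \o shift x) (h *: 1) - cur f x y) @[h --> 0^']
    --> A f (x, y).
  have E : (fun h : R => h^-1 *: ((f \o shift (x, y)) (h *: e1 R) - f (x, y)))
      = (fun h : R => h^-1 *: ((cur f ^~ y \o shift x) (h *: 1) - cur f x y)).
    apply/funext => h; rewrite /= /cur /e1; congr (_ *: (f _ - _)).
    by congr pair; rewrite /= scaler0 add0r.
  rewrite -E; exact: (d1 (x, y)).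
apply: DeriveDef; first by apply/cvg_ex; exists (A f (x, y)).
exact: cvg_lim H.
Qed.

Lemma cur_D2 f : smooth f -> D2 (cur f) (cur (B f)).
Proof.
move=> /smooth_partials[_ _ d2 _ _] x y.
have H : h^-1 *: ((cur f x \o shift y) (h *: 1) - cur f x y) @[h --> 0^']
    --> B f (x, y).
  have E : (fun h : R => h^-1 *: ((f \o shift (x, y)) (h *: e2 R) - f (x, y)))
      = (fun h : R => h^-1 *: ((cur f x \o shift y) (h *: 1) - cur f x y)).
    apply/funext => h; rewrite /= /cur /e2; congr (_ *: (f _ - _)).
    by congr pair; rewrite /= scaler0 add0r.
  rewrite -E; exact: (d2 (x, y)).
apply: DeriveDef; first by apply/cvg_ex; exists (B f (x, y)).
exact: cvg_lim H.
Qed.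

Lemma smooth_schwarz f : smooth f -> B (A f) = A (B f).
Proof.
move=> sf; have [_ _ _ s1 s2] := smooth_partials sf.
have [_ _ _ _ s12] := smooth_partials s1; have [_ _ _ s21 _] := smooth_partials s2.
apply/funext => -[x y].
exact: (mixed_partials (cur_D1 sf) (cur_D2 sf) (cur_D2 s1) (cur_D1 s2)
  (cur_cont2 s12) (cur_cont2 s21)).
Qed.

Lemma D1_zero (F G : R -> R -> R) : D1 F G -> (forall x y, F x y = 0) ->
  forall x y, G x y = 0.
Proof.
move=> dF F0 x y; have := dF x y.
have -> : F^~ y = cst 0 by apply/funext => t; exact: F0.
by move=> d; rewrite -(@derive_val _ _ _ _ _ _ _ d) derive_cst.
Qed.

Lemma D2_zero (F G : R -> R -> R) : D2 F G -> (forall x y, F x y = 0) ->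
  forall x y, G x y = 0.
Proof. by move=> /D2_flip dF F0 x y; exact: (D1_zero dF (fun a b => F0 b a)). Qed.

(** By Tonelli, the iterated integrals over all squares are bounded by the integral
    of [|f| ^ q] over the plane. *)
Lemma int2_profile_bounded (h : R -> R) (q : R) f : 1 <= q -> continuous h ->
  (forall s, 0 <= h s) -> (forall s, h s <= `|s| `^ q) -> cont2 (cur f) ->
  f \in Lfun (leb2 R) q%:E ->
  exists2 K, 0 <= K & forall L, 0 < L -> int2 L (fun x y => h (cur f x y)) <= K.
Proof.
move=> q1 ch h0 hq cf fq.
pose mu := @lebesgue_measure R.
have ifq := Lfun_integrable q1 fq.
pose Q (z : measurableTypeR R * measurableTypeR R) := (`|f z| `^ q)%:E.
have mfq : measurable_fun setT Q by have /integrableP[] := ifq.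
have Q0 z : (0 <= Q z)%E by rewrite lee_fin powR_ge0.
have fin : (\int[leb2 R]_z Q z)%E \is a fin_num.
  by have := integrable_fin_num measurableT ifq.
exists (fine (\int[leb2 R]_z Q z)%E).
  by rewrite fine_ge0 // integral_ge0.
move=> L L0; have chf := cont2_post ch cf.
rewrite -lee_fin fineK //.
have -> : (\int[leb2 R]_z Q z = \int[mu]_y fubini_G mu Q y)%E.
  exact: fubini_tonelli2.
have mG : measurable_fun setT (fubini_G mu Q).
  exact: measurable_fun_fubini_tonelli_G.
have G0 y : (0 <= fubini_G mu Q y)%E by exact: integral_ge0.
have cI := continuous_int1 (L := L) chf.
have EFint (g : R -> R) : continuous g ->
    ((int1 L g)%:E = \int[mu]_(x in `[(- L)%R, L]) (g x)%:E)%E.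
  move=> cg; rewrite int1E /Rintegral fineK //.
  by apply: integrable_fin_num => //; exact: integrable_itv.
rewrite /int2 EFint //.
apply: (@le_trans _ _ (\int[mu]_(y in `[(- L)%R, L]) fubini_G mu Q y)%E); last first.
  by apply: ge0_subset_integral.
apply: ge0_le_integral => //.
- by move=> y _; rewrite lee_fin int1_ge0.
- by have /integrableP[] := @integrable_itv R (- L) L _ cI.
- exact: measurable_funTS.
- move=> y _; rewrite EFint; last exact: cont2_slice1 chf.
  have mQy : measurable_fun setT (fun x : measurableTypeR R => Q (x, y)).
    by apply: (measurableT_comp mfq); exact: pair2_measurable.
  apply: (@le_trans _ _ (\int[mu]_(x in `[(- L)%R, L]) Q (x, y))%E); last first.
    by apply: ge0_subset_integral.
  apply: ge0_le_integral => //.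
  + by move=> x _; rewrite lee_fin.
  + by have /integrableP[] := @integrable_itv R (- L) L _ (cont2_slice1 (y := y) chf).
  + exact: measurable_funTS.
  + by move=> x _; rewrite lee_fin.
Qed.

End SmoothScalar.

(** * Stationary solutions *)

Lemma curl_algebra (R : comNzRingType) (aaau bbbu aaav abbv abu bbu aav abv
    abp u v au bu av bv : R) :
  - (aaau + bbbu) + (bu * au + u * abu + (bv * bu + v * bbu)) + abp = 0 ->
  - (aaav + abbv) + (au * av + u * aav + (av * bv + v * abv)) + abp = 0 ->
  au + bv = 0 ->
  (aaav - aaau) + (abbv - bbbu) = u * (aav - abu) + v * (abv - bbu).
Proof.
move=> E1 E2 /eqP; rewrite addr_eq0 => /eqP auE; move: E1 E2; rewrite auE.
by move=> E1 E2; apply/eqP; rewrite -subr_eq0 -(subrr 0) -{1}E1 -E2; apply/eqP; ring.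
Qed.

Lemma cancel_left (V : zmodType) (a b c : V) :
  a + b = 0 -> b - c = 0 -> a + c = 0.
Proof. by move=> ab /subr0_eq <-. Qed.

Lemma cancel_right (V : zmodType) (a b c : V) :
  b + c = 0 -> a - b = 0 -> a + c = 0.
Proof. by move=> bc /subr0_eq ->. Qed.

Section Stationary.
Variable R : realType.
Local Notation A f := ('D_(e1 R) f).
Local Notation B f := ('D_(e2 R) f).
Implicit Types (f U V p : R * R -> R).

Lemma smooth_A f : smooth f -> smooth (A f).
Proof. by case/smooth_partials. Qed.
Lemma smooth_B f : smooth f -> smooth (B f).
Proof. by case/smooth_partials. Qed.

Lemma smooth_cst f : smooth f -> (forall z, A f z = 0) ->
  (forall z, B f z = 0) -> forall z, f z = f (0, 0).
Proof.
move=> sf A0 B0 [x y]; apply: (@D12_cst _ (cur f)).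
- by apply: D1_ext (cur_D1 sf) _ => s t; exact: A0.
- by apply: D2_ext (cur_D2 sf) _ => s t; exact: B0.
Qed.

(** Here and below, equalities between derivatives are composed as terms instead of
    rewritten with: matching two different derivatives unfolds the limits that
    define them. *)
Lemma cur_A_D2 f : smooth f -> D2 (cur (A f)) (cur (A (B f))).
Proof.
move=> sf; exact: (eq_ind _ (fun g : R * R -> R => D2 (cur (A f)) (cur g))
  (cur_D2 (smooth_A sf)) _ (smooth_schwarz sf)).
Qed.

Section Lq.
Variables (q : R).
Hypothesis q1 : 1 < q.

Lemma liouville_Lq (f f1 f2 f11 f22 b1 b2 b11 b12 b21 b22 : R * R -> R) :
  cont2 (cur f) -> cont2 (cur f1) -> cont2 (cur f2) ->
  cont2 (cur f11) -> cont2 (cur f22) -> cont2 (cur b1) -> cont2 (cur b2) ->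
  cont2 (cur b11) -> cont2 (cur b12) -> cont2 (cur b21) -> cont2 (cur b22) ->
  D1 (cur f) (cur f1) -> D2 (cur f) (cur f2) ->
  D1 (cur f1) (cur f11) -> D2 (cur f2) (cur f22) ->
  D1 (cur b1) (cur b11) -> D2 (cur b1) (cur b12) ->
  D1 (cur b2) (cur b21) -> D2 (cur b2) (cur b22) ->
  (forall z, b11 z + b22 z = 0) ->
  (forall z, f11 z + f22 z = b1 z * f1 z + b2 z * f2 z) ->
  f \in Lfun (leb2 R) q%:E -> b11 \in Lfun (leb2 R) q%:E ->
  b12 \in Lfun (leb2 R) q%:E -> b21 \in Lfun (leb2 R) q%:E ->
  b22 \in Lfun (leb2 R) q%:E -> forall z, f z = 0.
Proof.
move=> cf cf1 cf2 cf11 cf22 cb1 cb2 cb11 cb12 cb21 cb22 df1 df2 df11 df22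
  db11 db12 db21 db22 div0 eqn fq b11q b12q b21q b22q [x y].
have [h [h1 [h2 [C0 [hp hq]]]]] := exists_profile q1.
have bd g := int2_profile_bounded (f := g) (ltW q1) (continuous_profile hp)
  (profile_ge0 hp) hq.
have [K0 K00 H0] := bd _ cf fq; have [K1 K10 H1] := bd _ cb11 b11q.
have [K2 K20 H2] := bd _ cb12 b12q; have [K3 K30 H3] := bd _ cb21 b21q.
have [K4 K40 H4] := bd _ cb22 b22q.
apply: (@liouville _ h h1 h2 C0 hp (cur f) (cur f1) (cur f2) (cur f11)
  (cur f22) (cur b1) (cur b2) (cur b11) (cur b12) (cur b21) (cur b22)
  (K0 + K1 + K2 + K3 + K4)) => //.
- by move=> s t; exact: div0.
- by move=> s t; exact: eqn.
- move=> L L0; apply: le_trans (H0 L L0) _; lra.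
- move=> L L0; apply: le_trans (H1 L L0) _; lra.
- move=> L L0; apply: le_trans (H2 L L0) _; lra.
- move=> L L0; apply: le_trans (H3 L L0) _; lra.
- move=> L L0; apply: le_trans (H4 L L0) _; lra.
Qed.

Let Lfun0 : (fun=> 0 : R) \in Lfun (leb2 R) q%:E.
Proof.
have q1' : (1 <= q%:E)%E by rewrite lee_fin ltW.
by have [] := @Lfun_submod_closed _ _ R (leb2 R) _ q1'.
Qed.

Let Lfun_sub f g : f \in Lfun (leb2 R) q%:E -> g \in Lfun (leb2 R) q%:E ->
  (fun z => f z - g z) \in Lfun (leb2 R) q%:E.
Proof.
have q1' : (1 <= q%:E)%E by rewrite lee_fin ltW.
move=> fq gq; have [_ /(_ (-1) _ _ gq fq)] := @Lfun_submod_closed _ _ R (leb2 R) _ q1'.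
by rewrite scaleN1r addrC.
Qed.

(** The Liouville theorem with zero drift. *)
Lemma harmonic_Lq_eq0 f : smooth f -> (forall z, A (A f) z + B (B f) z = 0) ->
  f \in Lfun (leb2 R) q%:E -> forall z, f z = 0.
Proof.
move=> sf lap fq.
have sA := smooth_A sf; have sB := smooth_B sf.
have sAA := smooth_A sA; have sBB := smooth_B sB.
have c0 : cont2 (cur (fun=> 0 : R)) by exact: (@cont2_cst _ 0).
have d10 : D1 (cur (fun=> 0 : R)) (cur (fun=> 0)) by exact: (@D1_snd _ (fun=> 0)).
have d20 : D2 (cur (fun=> 0 : R)) (cur (fun=> 0)) by exact: (@D2_fst _ (fun=> 0)).
apply: (liouville_Lq (cur_cont2 sf) (cur_cont2 sA) (cur_cont2 sB)
  (cur_cont2 sAA) (cur_cont2 sBB) c0 c0 c0 c0 c0 c0 (cur_D1 sf) (cur_D2 sf)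
  (cur_D1 sA) (cur_D2 sB) d10 d20 d10 d20) => // z.
- by rewrite addr0.
- by rewrite lap !mul0r addr0.
Qed.

(** The partial derivatives of a harmonic function are harmonic. *)
Lemma harmonic_grad_Lq f : smooth f -> (forall z, A (A f) z + B (B f) z = 0) ->
  A f \in Lfun (leb2 R) q%:E -> B f \in Lfun (leb2 R) q%:E ->
  (forall z, A f z = 0) /\ (forall z, B f z = 0).
Proof.
move=> sf lap Aq Bq; have sA := smooth_A sf; have sB := smooth_B sf.
have dA1 := cur_D1 (smooth_A sA); have dA2 := cur_D1 (smooth_B sB).
have dB1 := cur_D2 (smooth_A sA); have dB2 := cur_D2 (smooth_B sB).
have lap' x y : cur (A (A f)) x y + cur (B (B f)) x y = 0 by exact: lap.
have lapA := D1_zero (D1D dA1 dA2) lap'.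
have lapB := D2_zero (D2D dB1 dB2) lap'.
have EA := etrans (congr1 (fun g : R * R -> R => B g) (smooth_schwarz sf))
  (smooth_schwarz sB).
have EB := etrans (congr1 (fun g : R * R -> R => A g) (esym (smooth_schwarz sf)))
  (esym (smooth_schwarz sA)).
split.
- refine (harmonic_Lq_eq0 sA _ Aq) => -[x y].
  exact (etrans (congr1 (fun g => _ + g (x, y)) EA) (lapA x y)).
- refine (harmonic_Lq_eq0 sB _ Bq) => -[x y].
  exact (etrans (congr1 (fun g => g (x, y) + _) EB) (lapB x y)).
Qed.

(** The vorticity [A V - B U] is transported by the flow and diffuses, so it
    vanishes. A planar field without divergence and vorticity has harmonic
    components, whose gradients then vanish as well; the momentum equation is left
    with the gradient of the pressure. *)
Lemma liouville_stationary U V p : smooth U -> smooth V -> smooth p ->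
  (forall z, - (A (A U) z + B (B U) z) + (U z * A U z + V z * B U z) + A p z = 0) ->
  (forall z, - (A (A V) z + B (B V) z) + (U z * A V z + V z * B V z) + B p z = 0) ->
  (forall z, A U z + B V z = 0) ->
  A U \in Lfun (leb2 R) q%:E -> A V \in Lfun (leb2 R) q%:E ->
  B U \in Lfun (leb2 R) q%:E -> B V \in Lfun (leb2 R) q%:E ->
  [/\ forall z, U z = U (0, 0), forall z, V z = V (0, 0) &
      forall z, p z = p (0, 0)].
Proof.
move=> sU sV sp NS1 NS2 div0 AUq AVq BUq BVq.
have sAU := smooth_A sU; have sBU := smooth_B sU.
have sAV := smooth_A sV; have sBV := smooth_B sV.
have sAp := smooth_A sp; have sBp := smooth_B sp.
have sAAU := smooth_A sAU; have sABU := smooth_A sBU; have sBBU := smooth_B sBU.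
have sAAV := smooth_A sAV; have sABV := smooth_A sBV; have sBBV := smooth_B sBV.
have dAAU : D2 (cur (A (A U))) (cur (A (A (B U)))).
  exact: (eq_ind _ (fun g : R * R -> R => D2 (cur (A (A U))) (cur g)) (cur_A_D2 sAU) _
    (congr1 (fun g : R * R -> R => A g) (smooth_schwarz sU))).
(* Curl of the momentum equation: the pressure disappears by symmetry of its
   second derivatives, and the quadratic terms left over are the vorticity times
   the divergence. *)
have curl x y : (cur (A (A (A V))) x y - cur (A (A (B U))) x y) +
    (cur (A (B (B V))) x y - cur (B (B (B U))) x y) =
    cur U x y * (cur (A (A V)) x y - cur (A (B U)) x y) +
    cur V x y * (cur (A (B V)) x y - cur (B (B U)) x y).
  have E1 s t : - (cur (A (A U)) s t + cur (B (B U)) s t) +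
      (cur U s t * cur (A U) s t + cur V s t * cur (B U) s t) + cur (A p) s t = 0.
    exact: NS1.
  have E2 s t : - (cur (A (A V)) s t + cur (B (B V)) s t) +
      (cur U s t * cur (A V) s t + cur V s t * cur (B V) s t) + cur (B p) s t = 0.
    exact: NS2.
  have G1 := D2_zero (D2D (D2D (D2N (D2D dAAU (cur_D2 sBBU)))
    (D2D (D2M (cur_D2 sU) (cur_A_D2 sU)) (D2M (cur_D2 sV) (cur_D2 sBU))))
    (cur_A_D2 sp)) E1 x y.
  have G2 := D1_zero (D1D (D1D (D1N (D1D (cur_D1 sAAV) (cur_D1 sBBV)))
    (D1D (D1M (cur_D1 sU) (cur_D1 sAV)) (D1M (cur_D1 sV) (cur_D1 sBV))))
    (cur_D1 sBp)) E2 x y.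
  exact (curl_algebra G1 G2 (div0 (x, y))).
have W0 z : A V z - B U z = 0.
  apply: (@liouville_Lq (fun z => A V z - B U z)
    (fun z => A (A V) z - A (B U) z) (fun z => A (B V) z - B (B U) z)
    (fun z => A (A (A V)) z - A (A (B U)) z)
    (fun z => A (B (B V)) z - B (B (B U)) z)
    U V (A U) (B U) (A V) (B V)).
  - exact: cont2D (cur_cont2 sAV) (cont2N (cur_cont2 sBU)).
  - exact: cont2D (cur_cont2 sAAV) (cont2N (cur_cont2 sABU)).
  - exact: cont2D (cur_cont2 sABV) (cont2N (cur_cont2 sBBU)).
  - exact: cont2D (cur_cont2 (smooth_A sAAV)) (cont2N (cur_cont2 (smooth_A sABU))).
  - exact: cont2D (cur_cont2 (smooth_A sBBV)) (cont2N (cur_cont2 (smooth_B sBBU))).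
  - exact: cur_cont2.
  - exact: cur_cont2.
  - exact: cur_cont2.
  - exact: cur_cont2.
  - exact: cur_cont2.
  - exact: cur_cont2.
  - exact: D1D (cur_D1 sAV) (D1N (cur_D1 sBU)).
  - exact: D2D (cur_A_D2 sV) (D2N (cur_D2 sBU)).
  - exact: D1D (cur_D1 sAAV) (D1N (cur_D1 sABU)).
  - exact: D2D (cur_A_D2 sBV) (D2N (cur_D2 sBBU)).
  - exact: cur_D1.
  - exact: cur_D2.
  - exact: cur_D1.
  - exact: cur_D2.
  - exact: div0.
  - by case=> x y; exact: curl.
  - exact (Lfun_sub AVq BUq).
  - exact: AUq.
  - exact: BUq.
  - exact: AVq.
  - exact: BVq.
have divc x y : cur (A U) x y + cur (B V) x y = 0 by exact: div0.
have Wc x y : cur (A V) x y + - cur (B U) x y = 0 by exact: W0.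
have lapU z : A (A U) z + B (B U) z = 0.
  case: z => x y.
  have G1 := D1_zero (D1D (cur_D1 sAU) (cur_D1 sBV)) divc x y.
  have G2 := D2_zero (D2D (cur_A_D2 sV) (D2N (cur_D2 sBU))) Wc x y.
  exact (cancel_left G1 G2).
have lapV z : A (A V) z + B (B V) z = 0.
  case: z => x y.
  have G1 := D2_zero (D2D (cur_A_D2 sU) (cur_D2 sBV)) divc x y.
  have G2 := D1_zero (D1D (cur_D1 sAV) (D1N (cur_D1 sBU))) Wc x y.
  exact (cancel_right G1 G2).
have [AU0 BU0] := harmonic_grad_Lq sU lapU AUq BUq.
have [AV0 BV0] := harmonic_grad_Lq sV lapV AVq BVq.
split; try exact: smooth_cst.
apply: smooth_cst => // z.
- by have := NS1 z; rewrite lapU AU0 BU0 !mulr0 oppr0 !add0r.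
- by have := NS2 z; rewrite lapV AV0 BV0 !mulr0 oppr0 !add0r.
Qed.

End Lq.

End Stationary.

Lemma momentum_subst (V : pzRingType) (a b c d a' b' c' d' u v w : V) :
  a = a' -> b = b' -> c = c' -> d = d' ->
  - (a' + b') + (u * c' + v * d') + w = 0 -> - (a + b) + (u * c + v * d) + w = 0.
Proof. by move=> -> -> -> ->. Qed.

Theorem corollary1p3 (R : realType) (u : R * R -> R * R) (p : R * R -> R)
    (u_smooth : smooth u) (p_smooth : smooth p)
    (NS : stationary_navier_stokes u p)
    (grad_u : exists q : R, 1 < q /\ grad_in_Lq q u) :
  (exists c : R * R, forall x, u x = c) /\ (exists c : R, forall x, p x = c).
Proof.
have [q [q1 [A1q A2q B1q B2q]]] := grad_u.
have fstP : [/\ forall a b : R * R, (a - b).1 = a.1 - b.1,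
   forall (c : R) (a : R * R), (c *: a).1 = c *: a.1 & continuous (@fst R R)].
  by split => // z; exact: cvg_fst.
have sndP : [/\ forall a b : R * R, (a - b).2 = a.2 - b.2,
   forall (c : R) (a : R * R), (c *: a).2 = c *: a.2 & continuous (@snd R R)].
  by split => // z; exact: cvg_snd.
have post (phi : R * R -> R) (w : R * R -> R * R) :
    [/\ forall a b : R * R, phi (a - b) = phi a - phi b,
     forall (c : R) (a : R * R), phi (c *: a) = c *: phi a & continuous phi] ->
    smooth w -> [/\ smooth (phi \o w),
      'D_(e1 R) (phi \o w) = phi \o 'D_(e1 R) w &
      'D_(e2 R) (phi \o w) = phi \o 'D_(e2 R) w].
  case=> phiB phiZ cphi sw; have [_ d1 d2 _ _] := smooth_partials sw.
  split; first by move=> k; exact: Ck_post.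
  - by apply/funext => z; have [] := derive_post phiB phiZ cphi (d1 z).
  - by apply/funext => z; have [] := derive_post phiB phiZ cphi (d2 z).
have [_ _ _ sA sB] := smooth_partials u_smooth.
have [sU AU BU] := post _ _ fstP u_smooth.
have [sV AV BV] := post _ _ sndP u_smooth.
have [_ AAU _] := post _ _ fstP sA; have [_ _ BBU] := post _ _ fstP sB.
have [_ AAV _] := post _ _ sndP sA; have [_ _ BBV] := post _ _ sndP sB.
have at_point (f g : R * R -> R) z : f = g -> f z = g z by move=> ->.
have [Uc Vc pc] : [/\ forall z, (fst \o u) z = (fst \o u) (0, 0),
    forall z, (snd \o u) z = (snd \o u) (0, 0) & forall z, p z = p (0, 0)].
  refine (liouville_stationary q1 sU sV p_smooth _ _ _ _ _ _ _).
  - move=> z; have [/(congr1 fst) E _] := NS z.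
    exact (momentum_subst
      (etrans (congr1 (fun g : R * R -> R => 'D_(e1 R) g z) AU) (at_point _ _ z AAU))
      (etrans (congr1 (fun g : R * R -> R => 'D_(e2 R) g z) BU) (at_point _ _ z BBU))
      (at_point _ _ z AU) (at_point _ _ z BU) E).
  - move=> z; have [/(congr1 snd) E _] := NS z.
    exact (momentum_subst
      (etrans (congr1 (fun g : R * R -> R => 'D_(e1 R) g z) AV) (at_point _ _ z AAV))
      (etrans (congr1 (fun g : R * R -> R => 'D_(e2 R) g z) BV) (at_point _ _ z BBV))
      (at_point _ _ z AV) (at_point _ _ z BV) E).
  - move=> z; have [_ E] := NS z.
    exact (etrans (congr2 +%R (at_point _ _ z AU) (at_point _ _ z BV)) E).
  - exact (eq_ind_r (fun g => g \in Lfun (leb2 R) q%:E) A1q AU).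
  - exact (eq_ind_r (fun g => g \in Lfun (leb2 R) q%:E) A2q AV).
  - exact (eq_ind_r (fun g => g \in Lfun (leb2 R) q%:E) B1q BU).
  - exact (eq_ind_r (fun g => g \in Lfun (leb2 R) q%:E) B2q BV).
split; last by exists (p (0, 0)).
by exists (u (0, 0)) => x; apply: injective_projections; [exact: Uc|exact: Vc].
Qed.
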